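(* Let $\mathfrak m=\bigoplus_{p<0}\mathfrak g_p$ be a free pseudo-product fundamental graded Lie algebra of type $(m,n,\mu)$ with pseudo-product structure $(\mathfrak e,\mathfrak f)$ over $\mathbb C$, and let $\mathfrak g=\bigoplus_{p\in\mathbb Z}\mathfrak g_p$ be the prolongation of $(\mathfrak m;\mathfrak e,\mathfrak f)$. If $\mathfrak g_1\neq\{0\}$, then $\mathfrak g=\bigoplus_{p\in\mathbb Z}\mathfrak g_p$ is a finite-dimensional simple graded Lie algebra of type $(A_{m+n},\{\alpha_m,\alpha_{m+1}\})$.
   Context: All vector spaces are over $\mathbb C$. A graded Lie algebra (GLA) is a Lie algebra $\mathfrak g=\bigoplus_{p\in\mathbb Z}\mathfrak g_p$ with $\dim\mathfrak g_p<\infty$ and $[\mathfrak g_p,\mathfrak g_q]\subset\mathfrak g_{p+q}$; $\mathfrak g_-=\bigoplus_{p<0}\mathfrak g_p$. It is transitive if for $p\ge 0$ and $X\in\mathfrak g_p$, $[X,\mathfrak g_-]=\{0\}$ implies $X=0$. A fundamental graded Lie algebra (FGLA) is a finite-dimensional GLA $\mathfrak m=\bigoplus_{p<0}\mathfrak g_p$ with $\mathfrak g_{-1}\ne\{0\}$ that is generated by $\mathfrak g_{-1}$; it is of the $\mu$-th kind if $\mathfrak g_{-\mu}\neq\{0\}$ and $\mathfrak g_p=\{0\}$ for $p<-\mu$. A pseudo-product FGLA with pseudo-product structure $(\mathfrak e,\mathfrak f)$ is an FGLA $\mathfrak m$ with nonzero subspaces $\mathfrak e,\mathfrak f\subset\mathfrak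 g_{-1}$ such that $\mathfrak g_{-1}=\mathfrak e\oplus\mathfrak f$ and $[\mathfrak e,\mathfrak e]=[\mathfrak f,\mathfrak f]=\{0\}$; it is denoted $(\mathfrak m;\mathfrak e,\mathfrak f)$. If it is of the $\mu$-th kind, $\mu\ge2$, it is a free pseudo-product FGLA of type $(m,n,\mu)$ if $\dim\mathfrak e=m$, $\dim\mathfrak f=n$, and for every pseudo-product FGLA $\mathfrak m'=\bigoplus_{p<0}\mathfrak g'_p$ of the $\mu$-th kind with structure $(\mathfrak e',\mathfrak f')$, every surjective linear map $\varphi:\mathfrak g_{-1}\to\mathfrak g'_{-1}$ with $\varphi(\mathfrak e)\subset\mathfrak e'$, $\varphi(\mathfrak f)\subset\mathfrak f'$ extends uniquely to a GLA epimorphism $\mathfrak m\to\mathfrak m'$. The prolongation $\mathfrak g(\mathfrak m)=\bigoplus_{p\in\mathbb Z}\mathfrak g(\mathfrak m)_p$ of an FGLA $\mathfrak m$ is the maximal transitive GLA with $\mathfrak g(\mathfrak m)_p=\mathfrak g_p$ for all $p<0$. Explicitly, $\mathfrak g(\mathfrak m)_0$ is the Lie algebra of degree-$0$ derivations of $\mathfrak m$, and for $k\ge1$, inductively, $\mathfrak g(\mathfrak m)_k$ is the space of linear maps $X:\mathfrak m\to\bigoplus_{p\le k-1}\mathfrak g(\mathfrak m)_p$ of degree $k$ with $X([u,v])=[X(u),v]+[u,X(v)]$ for all $u,v\in\mathfrak m$, where $[X,u]=-[u,X]=X(u)$; for $X,Y$ of nonnegative degree, $[X,Y](u)=[X,[Y,u]]-[Y,[X,u]]$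 inductively. The prolongation $\mathfrak g=\bigoplus_{p}\mathfrak g_p$ of $(\mathfrak m;\mathfrak e,\mathfrak f)$ is the graded subalgebra of $\mathfrak g(\mathfrak m)$ with negative part $\mathfrak m$, with $\mathfrak g_0$ the Lie algebra of degree-$0$ derivations of $\mathfrak m$ preserving $\mathfrak e$ and $\mathfrak f$, and, inductively for $p\ge1$, $\mathfrak g_p=\{X\in\mathfrak g(\mathfrak m)_p:[X,\mathfrak g_k]\subset\mathfrak g_{p+k}\text{ for all }k<0\}$. Type of a simple GLA: let $\mathfrak g=\bigoplus_p\mathfrak g_p$ be a finite-dimensional simple GLA over $\mathbb C$ with $\mathfrak g_-$ an FGLA. Let $E\in\mathfrak g_0$ satisfy $[E,x]=px$ for $x\in\mathfrak g_p$; choose a Cartan subalgebra $\mathfrak h$ of $\mathfrak g_0$ (it is a Cartan subalgebra of $\mathfrak g$ containing $E$) and a simple root system $\Pi=\{\alpha_1,\dots,\alpha_l\}$ with $\alpha_i(E)\ge0$ for all $i$ (then $\alpha_i(E)\in\{0,1\}$). Put $\Pi_1=\{\alpha_i:\alpha_i(E)=1\}$. If $\mathfrak g$ has Dynkin diagram $X_l$, with simple roots numbered as in Bourbaki's tables, $\mathfrak g$ is said to be of type $(X_l,\Pi_1)$; types differing by a diagram automorphism are identified. *)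

(* Defs.v *)
From HB Require Import structures.
From mathcomp Require Import all_boot all_order all_algebra.
From mathcomp Require Import all_real_closed.
From mathcomp Require Import boolp classical_sets reals.

Set Implicit Arguments.
Unset Strict Implicit.
Unset Printing Implicit Defensive.

Import Order.TTheory GRing.Theory Num.Theory.

Local Open Scope classical_set_scope.
Local Open Scope ring_scope.

HB.mixin Record Lmodule_isLieAlgebra (K : fieldType) L of GRing.Lmodule K L := {
  lie : L -> L -> L;
  lie_linearl : forall (a : K) (x x' y : L),
    lie (a *: x + x') y = a *: lie x y + lie x' y;
  lie_linearr : forall (a : K) (x y y' : L),
    lie x (a *: y + y') = a *: lie x y + lie x y';
  liexx : forall x : L, lie x x = 0;
  lie_jacobi : forall x y z : L,
    lie x (lie y z) + lie y (lie z x) + lie z (lie x y) = 0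
}.

#[short(type="lieAlgType")]
HB.structure Definition LieAlgebra (K : fieldType) :=
  {L of Lmodule_isLieAlgebra K L & GRing.Lmodule K L}.

#[short(type="finLieAlgType")]
HB.structure Definition FinLieAlgebra (K : fieldType) :=
  {L of LieAlgebra K L & Vector K L}.

Notation "[lie x , y ]" := (lie x y)
  (at level 0, x, y at level 200, format "[lie  x ,  y ]") : ring_scope.

Definition lie_hom (K : fieldType) (L L' : lieAlgType K) (f : L -> L') : Prop :=
  forall x y, f [lie x, y] = [lie f x, f y].

Section Graded.
Variables (K : fieldType) (L : lieAlgType K).
Implicit Type g : int -> set L.

Definition fin_dim_subspace (S : set L) : Prop :=
  exists (d : nat) (b : 'I_d -> L),
    S = [set \sum_(i < d) c i *: b i | c in [set: 'I_d -> K]].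

Record is_gla g : Prop := IsGLA {
  gla_fin_dim : forall p, fin_dim_subspace (g p);
  gla_span : forall x, exists (s : seq int) (c : int -> L),
    (forall p, g p (c p)) /\ x = \sum_(p <- s) c p;
  gla_indep : forall (s : seq int) (c : int -> L), uniq s ->
    (forall p, g p (c p)) -> \sum_(p <- s) c p = 0 ->
    forall p, p \in s -> c p = 0;
  gla_lie : forall p q x y, g p x -> g q y -> g (p + q) [lie x, y]
}.

Definition transitive_gla g : Prop :=
  forall p x, 0 <= p -> g p x ->
    (forall q y, q < 0 -> g q y -> [lie x, y] = 0) -> x = 0.

End Graded.

Definition vgrading (K : fieldType) (L : finLieAlgType K)
  (g : int -> {vspace L}) : int -> set L := fun p => [set` g p].

Section FiniteDimensional.
Variables (K : fieldType) (L : finLieAlgType K).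
Implicit Types (g : int -> {vspace L}) (U V h : {vspace L}).

Definition lie_span U V : {vspace L} :=
  <<[seq [lie x, y] | x <- vbasis U, y <- vbasis V]>>%VS.

Definition lie_subalgebra U : Prop := (lie_span U U <= U)%VS.

Definition lie_ideal U : Prop := (lie_span fullv U <= U)%VS.

Definition lie_nilpotent U : Prop :=
  exists k : nat, iter k (lie_span U) U = 0%VS.

Definition lie_simple : Prop :=
  lie_span fullv fullv <> 0%VS /\
  forall U, lie_ideal U -> U = 0%VS \/ U = fullv.

(* g_- is a subalgebra, so it is generated by g_(-1) exactly when every
   subalgebra of L containing g_(-1) contains all the g_p, p < 0. *)
Definition fundamental g : Prop :=
  g (-1) <> 0%VS /\
  forall U, lie_subalgebra U -> (g (-1) <= U)%VS ->
    forall p, p < 0 -> (g p <= U)%VS.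

Definition is_fgla g : Prop :=
  [/\ is_gla (vgrading g), forall p, 0 <= p -> g p = 0%VS & fundamental g].

Definition of_kind g (mu : nat) : Prop :=
  g (- mu%:Z) <> 0%VS /\ forall p, p < - mu%:Z -> g p = 0%VS.

Definition pseudo_product_fgla g (e f : {vspace L}) : Prop :=
  [/\ is_fgla g,
      [/\ e <> 0%VS, f <> 0%VS, (e + f)%VS = g (-1) & (e :&: f)%VS = 0%VS],
      lie_span e e = 0%VS & lie_span f f = 0%VS].

End FiniteDimensional.

Definition gla_epi (K : fieldType) (L L' : finLieAlgType K)
    (g : int -> {vspace L}) (g' : int -> {vspace L'}) (psi : 'Hom(L, L')) : Prop :=
  [/\ lie_hom psi, forall p, (psi @: g p <= g' p)%VS & limg psi = fullv].

(* A linear map g_(-1) -> g'_(-1) is given by a linear map phi on the whole of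
   M, of which only the restriction to g_(-1) is used. *)
Definition free_pseudo_product_fgla (K : fieldType) (M : finLieAlgType K)
    (g : int -> {vspace M}) (e f : {vspace M}) (m n mu : nat) : Prop :=
  [/\ pseudo_product_fgla g e f,
      (2 <= mu)%N /\ of_kind g mu,
      \dim e = m /\ \dim f = n &
      forall (M' : finLieAlgType K) (g' : int -> {vspace M'})
             (e' f' : {vspace M'}),
        pseudo_product_fgla g' e' f' -> of_kind g' mu ->
        forall phi : 'Hom(M, M'),
          (phi @: g (-1))%VS = g' (-1) ->
          (phi @: e <= e')%VS -> (phi @: f <= f')%VS ->
          exists! psi : 'Hom(M, M'),
            gla_epi g g' psi /\ {in g (-1), psi =1 phi}].

Section Prolongation.
Variables (K : fieldType) (M : finLieAlgType K) (gM : int -> {vspace M}).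
Variables (G : lieAlgType K) (gG : int -> set G) (iota : {linear M -> G}).

(* (G, gG) is the prolongation of the FGLA (M, gM), with M identified with the
   negative part of G through iota: for k >= 0 the map X |-> [X, -] identifies
   gG k with the space of all linear maps D : M -> G of degree k such that
   D [u, v] = [D u, v] + [u, D v].  It is injective by pro_transitive and
   surjective by pro_full.  For k = 0 such a D takes its values in iota M, so
   that it is a degree-0 derivation of M; the bracket of elements of
   nonnegative degree is determined by the Jacobi identity. *)
Record is_prolongation : Prop := IsProlongation {
  pro_gla : is_gla gG;
  pro_inj : injective iota;
  pro_hom : lie_hom iota;
  pro_neg : forall p, p < 0 -> gG p = iota @` vgrading gM p;
  pro_transitive : transitive_gla gG;
  pro_full : forall (k : int) (D : {linear M -> G}), 0 <= k ->
    (forall p u, u \in gM p -> gG (p + k) (D u)) ->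
    (forall u v, D [lie u, v] = [lie D u, iota v] + [lie iota u, D v]) ->
    exists2 X, gG k X & forall u, D u = [lie X, iota u]
}.

Variables e f : {vspace M}.

Definition preserves (X : G) (U : {vspace M}) : Prop :=
  forall u, u \in U -> exists2 v, v \in U & [lie X, iota u] = iota v.

(* The homogeneous components, as subsets of G, of the prolongation of
   (M; e, f).  In pp_pro_pos the components of negative degree q of the
   subalgebra are those of G. *)
Inductive pp_prolongation : int -> G -> Prop :=
| pp_pro_neg p X : p < 0 -> gG p X -> pp_prolongation p X
| pp_pro_zero X : gG 0 X -> preserves X e -> preserves X f ->
    pp_prolongation 0 X
| pp_pro_pos p X : 0 < p -> gG p X ->
    (forall q Y, q < 0 -> gG q Y -> pp_prolongation (p + q) [lie X, Y]) ->
    pp_prolongation p X.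

End Prolongation.

Section Type_of_simple.
Variables (K : numFieldType) (L : finLieAlgType K).
Implicit Types (h s : {vspace L}).

Definition cartan_subalgebra h s : Prop :=
  [/\ (h <= s)%VS, lie_subalgebra h, lie_nilpotent h &
      forall x, x \in s -> (forall y, y \in h -> [lie x, y] \in h) -> x \in h].

Notation dual h := 'Hom(subvs_of h, K^o).

Definition in_root_space h (alpha : dual h) (x : L) : Prop :=
  forall t : subvs_of h, [lie vsval t, x] = (alpha t : K) *: x.

Definition is_root h (alpha : dual h) : Prop :=
  alpha != 0 /\ exists2 x, x != 0 & in_root_space alpha x.

Definition simple_root_system h (l : nat) (alpha : l.-tuple (dual h)) : Prop :=
  [/\ basis_of fullv alpha,
      forall i, is_root (tnth alpha i) &
      forall beta, is_root beta -> exists c : 'I_l -> nat,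
        beta = \sum_i (c i)%:R *: tnth alpha i \/
        beta = - \sum_i (c i)%:R *: tnth alpha i].

Definition is_coroot h (alpha : dual h) (t : subvs_of h) : Prop :=
  alpha t = 2 /\
  exists x y, [/\ in_root_space alpha x, in_root_space (- alpha) y &
                  vsval t = [lie x, y]].

(* The Dynkin diagram X_l with its numbering is encoded by its Cartan matrix
   A i j = <alpha_i, alpha_j^vee>.  Vertices are numbered from 0, and the
   numbering of the simple roots is existentially quantified, so that types
   differing by a diagram automorphism are identified. *)
Definition simple_gla_of_type (g : int -> {vspace L})
    (l : nat) (A : 'M[int]_l) (Pi1 : {set 'I_l}) : Prop :=
  [/\ is_gla (vgrading g), lie_simple L, fundamental g &
      exists (h : {vspace L}) (E : subvs_of h) (alpha : l.-tuple (dual h))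
             (alphav : 'I_l -> subvs_of h),
        [/\ cartan_subalgebra h (g 0),
            forall p x, x \in g p -> [lie vsval E, x] = p%:~R *: x,
            simple_root_system alpha /\
              (forall i, 0 <= (tnth alpha i E : K)),
            (forall j, is_coroot (tnth alpha j) (alphav j)) /\
              (forall i j, tnth alpha i (alphav j) = (A i j)%:~R) &
            Pi1 = [set i | tnth alpha i E == 1]%SET]].

End Type_of_simple.

Definition cartan_matrix_A (l : nat) : 'M[int]_l :=
  \matrix_(i, j) (if i == j then 2
                  else if (i.+1 == j :> nat) || (j.+1 == i :> nat) then -1
                  else 0).

(* {alpha_m, alpha_(m+1)} for simple roots alpha_1, ..., alpha_(m+n) *)
Definition roots_m_m1 (m n : nat) : {set 'I_(m + n)} :=
  [set i : 'I_(m + n) | (i.+1 == m) || (i.+1 == m.+1)]%SET.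

(* Main.v *)
Require Import Defs.
From HB Require Import structures.
From mathcomp Require Import all_boot all_order all_algebra.
From mathcomp Require Import all_real_closed.
From mathcomp Require Import boolp classical_sets reals.
From mathcomp Require Import zify ring.

(** If [mu = 2], then [M] is the negative part of the grading of [sl_(m+n+1)]
    by blocks of sizes [m], [1], [n].  The embedding of [sl_(m+n+1)] into the
    prolongation is built degree by degree from the fullness of the
    prolongation; it is bracket preserving by transitivity, injective by
    simplicity, and onto because every derivation of nonnegative degree from the
    negative part of [sl_(m+n+1)] to [sl_(m+n+1)] is inner (provided that it
    preserves [e] and [f] when the degree is 0).

    If [mu >= 3], then [g_1 = 0].  For [X] in [g_1], [a] in [e], [b] in [f], apply
    [X] to [ad(a)^mu b = 0] and to [ad(b) ad(a)^(mu-1) b = 0], and project to the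
    quotient of [M] generated by two elements whose brackets of degree two in
    the second one vanish.  This gives two linear relations between the
    components of [[X, a]] and [[X, b]] in [gl(e) + gl(f)].  Together with the two
    relations obtained by exchanging [e] and [f] they force
    [(mu - 1)^2 = 2] unless all these components vanish. *)

Set Implicit Arguments.
Unset Strict Implicit.
Unset Printing Implicit Defensive.

Import Order.TTheory GRing.Theory Num.Theory.

Local Open Scope classical_set_scope.
Local Open Scope ring_scope.

(** No basis of [M] is ever constructed: freeness enters only through maps of [M] onto test
    algebras. The universal property speaks of targets of kind exactly [mu], so the test algebra
    must have that kind. [filiform K mu] does: it is generated by [fil_a] and [fil_v 0], and any
    nonzero functionals on [e] and on [f] define a map of [M] onto it. For [mu = 2] it is the
    Heisenberg algebra, and the same maps show that the brackets of a basis of [f] with a basis of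
    [e] are independent, so that [M] is as large as the negative part of [sl_(m+n+1)].

    A single term separates the two cases. The element [[X, [a, b]]] contains a multiple of [a]. In
    kind two it survives the bracket with [b] and alters the second relation, which after the
    exchange of [e] and [f] becomes the first one again. In kind at least three a further [ad(a)]
    kills it, and the relations are independent because 2 is not the square of an integer. *)

Section LieBasics.
Variables (K : fieldType) (L : lieAlgType K).
Implicit Types x y z : L.

Fact lie_is_linear x : linear (lie x).
Proof. by move=> a y y'; exact: lie_linearr. Qed.
HB.instance Definition _ x := GRing.isLinear.Build K L L *:%R (lie x) (lie_is_linear x).

Lemma lieDl x x' y : [lie x + x', y] = [lie x, y] + [lie x', y].
Proof. by rewrite -[x]scale1r lie_linearl !scale1r. Qed.

Lemma lieC x y : [lie x, y] = - [lie y, x].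
Proof.
apply/eqP; rewrite -addr_eq0; apply/eqP.
by have := liexx (x + y); rewrite lieDl !linearD /= !liexx add0r addr0.
Qed.

Lemma lieZl a x y : [lie a *: x, y] = a *: [lie x, y].
Proof. by rewrite lieC linearZ /= lieC scalerN opprK. Qed.

Lemma lieNl x y : [lie - x, y] = - [lie x, y].
Proof. by rewrite lieC linearN /= opprK lieC. Qed.

Lemma lieBl x x' y : [lie x - x', y] = [lie x, y] - [lie x', y].
Proof. by rewrite lieDl lieNl. Qed.

Lemma lie0l y : [lie 0, y] = 0.
Proof. by rewrite lieC linear0 oppr0. Qed.

Lemma lie_suml I (r : seq I) (P : pred I) (F : I -> L) y :
  [lie \sum_(i <- r | P i) F i, y] = \sum_(i <- r | P i) [lie F i, y].
Proof.
rewrite lieC linear_sum /= -sumrN.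
by apply: eq_bigr => i _; rewrite -lieC.
Qed.

Lemma lie_leibniz x y z :
  [lie x, [lie y, z]] = [lie [lie x, y], z] + [lie y, [lie x, z]].
Proof.
have /eqP := lie_jacobi x y z; rewrite addrAC addr_eq0 => /eqP.
rewrite (lieC z x) linearN opprK => <-.
by rewrite addrCA (lieC z [lie x, y]) addrN addr0.
Qed.

Lemma lie_leibnizl x y z :
  [lie [lie x, y], z] = [lie [lie x, z], y] + [lie x, [lie y, z]].
Proof. by rewrite (lie_leibniz x y z) (lieC [lie x, z] y) addrCA addNr addr0. Qed.

End LieBasics.

(** * Subspaces cut out by linear conditions, and separating functionals *)

Section SubspacePredicates.
Variables (K : fieldType) (V : vectType K).

(** A subspace of maximal dimension inside [P] works: adding the line of any vector satisfying [P]
    stays inside [P], hence does not enlarge it. This turns a linear condition stated in [Prop] into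
    a [{vspace V}], to which generation arguments apply. *)
Lemma vspace_of_pred (P : V -> Prop) : P 0 ->
  (forall a x y, P x -> P y -> P (a *: x + y)) ->
  exists U : {vspace V}, forall x, x \in U <-> P x.
Proof.
move=> P0 Plin.
pose Q d := `[< exists U : {vspace V}, \dim U = d /\ forall x, x \in U -> P x >].
have Qex : exists d, Q d.
  by exists 0; apply/asboolP; exists 0%VS; rewrite dimv0; split=> // x; rewrite memv0 => /eqP->.
have Qmax d : Q d -> (d <= \dim {:V})%N.
  by move=> /asboolP[U [<- _]]; apply: dimvS; exact: subvf.
case: (ex_maxnP Qex Qmax) => d /asboolP[U [dU PU]] dmax.
exists U => x; split=> [/PU//|Px].
have /dmax : Q (\dim (U + <[x]>)%VS).
  apply/asboolP; exists (U + <[x]>)%VS; split=> // _ /memv_addP[u uU [_ /vlineP[a ->] ->]].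
  by rewrite addrC; apply: Plin => //; exact: PU.
rewrite -dU => le; have /eqP -> : U == (U + <[x]>)%VS by rewrite eqEdim addvSl.
by rewrite (subvP (addvSr U <[x]>%VS)) ?memv_line.
Qed.

(** The codomain may be infinite dimensional, as the prolongation is before it is identified. *)
Lemma vspace_ker (W : lmodType K) (f : {linear V -> W}) :
  exists U : {vspace V}, forall x, x \in U <-> f x = 0.
Proof.
apply: vspace_of_pred => [|a x y fx fy]; first by rewrite linear0.
by rewrite linearP fx fy scaler0 addr0.
Qed.

(** Subtracting the projection to [W] kills [W] but not [x]; the functional is the coordinate along
    what remains of [x]. *)
Lemma functional_separating (W : {vspace V}) x : x \notin W ->
  exists2 xi : {linear V -> K^o}, forall w, w \in W -> xi w = 0 & xi x = 1.
Proof.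
move=> xW; pose y := x - projv W x.
have y0 : y != 0 by rewrite subr_eq0; apply: contra xW => /eqP ->; rewrite memv_proj.
pose z u := u - projv W u.
have zl : linear z by move=> a u v; rewrite /z linearP /= scalerBr opprD addrACA.
pose zL : {linear V -> V} := HB.pack z (GRing.isLinear.Build _ _ _ _ z zl).
have frY : free [tuple y] by rewrite seq1_free.
exists (coord [tuple y] ord0 \o (projv <[y]> \o zL)) => [w wW|] /=.
  by rewrite /z projv_id // subrr !linear0.
rewrite -/(y) projv_id ?memv_line //.
by apply: etrans (coord_free ord0 ord0 frY) _; rewrite eqxx.
Qed.

End SubspacePredicates.

(** * Brackets of subspaces, and gradings given by projectors *)

Section LieSpan.
Variables (K : fieldType) (L : finLieAlgType K).
Implicit Types U V W : {vspace L}.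

Lemma lie_span_subP U V W :
  (lie_span U V <= W)%VS <-> forall x y, x \in U -> y \in V -> [lie x, y] \in W.
Proof.
split=> [/span_subvP sW x y xU yV|sW].
  rewrite (coord_vbasis xU) (coord_vbasis yV) lie_suml.
  apply: memv_suml => i _; rewrite linear_sum /=; apply: memv_suml => j _.
  rewrite lieZl linearZ /= !memvZ // sW //.
  by apply/allpairsP; exists ((vbasis U)`_i, (vbasis V)`_j); rewrite !mem_nth ?size_tuple.
by apply/span_subvP => _ /allpairsP[[x y] [/= /vbasis_mem xU /vbasis_mem yV ->]]; exact: sW.
Qed.

Lemma lie_span0P U V :
  lie_span U V = 0%VS <-> forall x y, x \in U -> y \in V -> [lie x, y] = 0.
Proof.
split=> [E x y xU yV|h].
  apply/eqP; rewrite -memv0 -E; have /lie_span_subP := subvv (lie_span U V); exact.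
apply/eqP; rewrite -subv0; apply/lie_span_subP => x y xU yV.
by rewrite h // memv0.
Qed.

Lemma fin_dim_vspace U : fin_dim_subspace [set` U].
Proof.
exists (\dim U), (fun i => (vbasis U)`_i); apply/seteqP; split=> [x /= xU|_ /= [c _ <-]].
  exists (fun i => coord (vbasis U) i x) => //; exact/esym/coord_vbasis.
by apply: memv_suml => i _; rewrite memvZ // vbasis_mem // mem_nth ?size_tuple.
Qed.

(** Independence of the components follows by applying [pr p] to a vanishing sum; [s0] is a finite
    list of degrees that serves all elements. *)
Lemma is_gla_proj (g : int -> {vspace L}) (pr : int -> L -> L) (s0 : seq int) :
    (forall p, linear (pr p)) ->
    (forall p x, pr p x \in g p) ->
    (forall p x, x \in g p -> pr p x = x) ->
    (forall p q x, p != q -> x \in g q -> pr p x = 0) ->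
    (forall x, x = \sum_(p <- s0) pr p x) ->
    (forall p q x y, x \in g p -> y \in g q -> [lie x, y] \in g (p + q)) ->
  is_gla (vgrading g).
Proof.
move=> prl prg prid pr0 prs glie; split=> //.
- by move=> p; exact: fin_dim_vspace.
- by move=> x; exists s0, (pr ^~ x); split=> // p; exact: prg.
- move=> s c us cg cs p ps.
  pose prL : {linear L -> L} := HB.pack (pr p) (GRing.isLinear.Build _ _ _ _ (pr p) (prl p)).
  have := congr1 prL cs; rewrite linear0 linear_sum /= (bigD1_seq p) //= prid ?cg //.
  by rewrite big1 ?addr0 // => q qp; apply: (pr0 p q); rewrite ?cg // eq_sym.
Qed.

End LieSpan.

(** * The Lie algebra sl_N *)

Section DeltaMx.
Variables (R : pzRingType) (n : nat).

Lemma mulmx_deltaE (A : 'M[R]_n) i j r c :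
  (A *m (delta_mx i j : 'M[R]_n)) r c = A r i * (c == j)%:R.
Proof.
rewrite mxE (bigD1 i) //= mxE eqxx big1 ?addr0 // => k ki.
by rewrite mxE (negPf ki) mulr0.
Qed.

Lemma mul_delta_mxE (A : 'M[R]_n) i j r c :
  ((delta_mx i j : 'M[R]_n) *m A) r c = (r == i)%:R * A j c.
Proof.
rewrite mxE (bigD1 j) //= mxE eqxx andbT big1 ?addr0 // => k ki.
by rewrite mxE (negPf ki) andbF mul0r.
Qed.

End DeltaMx.

Definition traceless (K : fieldType) (N : nat) : {vspace 'M[K]_N} :=
  lker (linfun (@mxtrace K N : 'M[K]_N -> K^o)).

Definition sl (K : fieldType) (N : nat) := subvs_of (traceless K N).

HB.instance Definition _ (K : fieldType) (N : nat) := Vector.on (sl K N).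

Section SlLie.
Variables (K : fieldType) (N : nat).
Implicit Types (A B : 'M[K]_N) (x y z : sl K N).

Lemma mem_traceless A : (A \in traceless K N) = (\tr A == 0).
Proof. by rewrite memv_ker lfunE. Qed.

Definition to_sl A : sl K N := vsproj (traceless K N) A.

Lemma to_slK A : \tr A = 0 -> vsval (to_sl A) = A.
Proof. by move=> A0; rewrite vsprojK // mem_traceless A0. Qed.

Lemma sl_trace x : \tr (vsval x) = 0.
Proof. by apply/eqP; rewrite -mem_traceless subvsP. Qed.

Lemma sl_ext x y : (forall r c, vsval x r c = vsval y r c) -> x = y.
Proof. by move=> xy; apply: subvs_inj; apply/matrixP => r c; exact: xy. Qed.

Lemma sl_entryD x y r c : vsval (x + y) r c = vsval x r c + vsval y r c.
Proof. by rewrite linearD mxE. Qed.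

Lemma sl_entryZ a x r c : vsval (a *: x) r c = a * vsval x r c.
Proof. by rewrite linearZ mxE. Qed.

Lemma sl_entryN x r c : vsval (- x) r c = - vsval x r c.
Proof. by rewrite linearN mxE. Qed.

Lemma sl_entry0 r c : vsval (0 : sl K N) r c = 0.
Proof. by rewrite linear0 mxE. Qed.

Definition sl_lie x y : sl K N :=
  to_sl (vsval x *m vsval y - vsval y *m vsval x).

Lemma val_sl_lie x y :
  vsval (sl_lie x y) = vsval x *m vsval y - vsval y *m vsval x.
Proof. by rewrite to_slK // linearB /= mxtrace_mulC subrr. Qed.

Fact sl_lie_linearl a x x' y :
  sl_lie (a *: x + x') y = a *: sl_lie x y + sl_lie x' y.
Proof.
apply: subvs_inj; rewrite linearP val_sl_lie [vsval (_ + _)]linearP /= mulmxDl mulmxDr.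
by rewrite -scalemxAl -scalemxAr !val_sl_lie scalerBr opprD addrACA.
Qed.

Fact sl_liexx x : sl_lie x x = 0.
Proof. by apply: subvs_inj; rewrite val_sl_lie subrr linear0. Qed.

Fact sl_lie_linearr a x y y' :
  sl_lie x (a *: y + y') = a *: sl_lie x y + sl_lie x y'.
Proof.
apply: subvs_inj; rewrite linearP val_sl_lie [vsval (_ + _)]linearP /= mulmxDl mulmxDr.
by rewrite -scalemxAl -scalemxAr !val_sl_lie scalerBr opprD addrACA.
Qed.

Fact sl_jacobi x y z :
  sl_lie x (sl_lie y z) + sl_lie y (sl_lie z x) + sl_lie z (sl_lie x y) = 0.
Proof.
apply: subvs_inj; rewrite !linearD linear0 /= !val_sl_lie.
rewrite !(mulmxBl, mulmxBr) !mulmxA; apply/matrixP => r c; rewrite !mxE.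
ring.
Qed.

HB.instance Definition _ := Lmodule_isLieAlgebra.Build K (sl K N)
  sl_lie_linearl sl_lie_linearr sl_liexx sl_jacobi.

Lemma val_lie x y : vsval [lie x, y] = vsval x *m vsval y - vsval y *m vsval x.
Proof. exact: val_sl_lie. Qed.

Lemma val_lieE x y r c : vsval [lie x, y] r c =
  \sum_k (vsval x r k * vsval y k c - vsval y r k * vsval x k c).
Proof. by rewrite val_lie !mxE sumrB. Qed.

Definition elem_sl r c : sl K N := to_sl (delta_mx r c).

Lemma val_elem r c : r != c -> vsval (elem_sl r c) = delta_mx r c.
Proof.
move=> rc; rewrite to_slK // /mxtrace big1 // => i _; rewrite mxE.
by case: eqP => [->|] //=; rewrite (negPf rc).
Qed.

Definition elem_diag r c : sl K N := to_sl (delta_mx r r - delta_mx c c).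

Lemma val_elem_diag r c : vsval (elem_diag r c) = delta_mx r r - delta_mx c c.
Proof.
have tr1 i : \tr (delta_mx i i : 'M[K]_N) = 1.
  rewrite /mxtrace (bigD1 i) //= mxE eqxx big1 ?addr0 // => j ji.
  by rewrite mxE (negPf ji).
by rewrite to_slK // linearB /= !tr1 subrr.
Qed.

Lemma val_lie_elem x i j r c : i != j ->
  vsval [lie x, elem_sl i j] r c =
    vsval x r i * (c == j)%:R - (r == i)%:R * vsval x j c.
Proof. by move=> ij; rewrite val_lie val_elem // !mxE -mulmx_deltaE -mul_delta_mxE !mxE. Qed.

Lemma lie_elem i j k : i != j -> j != k -> i != k ->
  [lie elem_sl i j, elem_sl j k] = elem_sl i k.
Proof.
move=> ij jk ik; apply: sl_ext => r c.
rewrite val_lie_elem // !val_elem // !mxE eqxx andbT [k == i]eq_sym (negPf ik) /= mulr0 subr0.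
by rewrite -natrM mulnb.
Qed.

Lemma lie_elem_opp i j : i != j ->
  [lie elem_sl i j, elem_sl j i] = elem_diag i j.
Proof.
move=> ij; apply: sl_ext => r c.
rewrite val_lie_elem 1?eq_sym // val_elem // val_elem_diag !mxE !eqxx andbT /=.
by rewrite [i == c]eq_sym -!natrM !mulnb.
Qed.

(** The diagonal can be written with the differences [elem_diag r r0] because the surplus multiple
    of the unit at [r0] is the trace. *)
Lemma sl_sum_elem x (r0 : 'I_N) : x = \sum_r (\sum_(c | c != r) vsval x r c *: elem_sl r c)
   + \sum_r vsval x r r *: elem_diag r r0.
Proof.
apply: subvs_inj; rewrite linearD !linear_sum /=.
rewrite (eq_bigr (fun r => \sum_(c | c != r) vsval x r c *: delta_mx r c)); last first.
  move=> r _; rewrite linear_sum; apply: eq_bigr => c cr.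
  by rewrite linearZ /= val_elem // eq_sym.
rewrite [X in _ + X](eq_bigr
  (fun r => vsval x r r *: delta_mx r r - vsval x r r *: delta_mx r0 r0)); last first.
  by move=> r _; rewrite linearZ /= val_elem_diag scalerBr scalerN.
rewrite sumrB -scaler_suml -[X in X *: delta_mx r0 _]/(\tr (vsval x)) sl_trace scale0r subr0.
rewrite -big_split /= {1}[vsval x]matrix_sum_delta.
by apply: eq_bigr => r _; rewrite (bigD1 r) //= addrC.
Qed.

Definition sl_supp (S : rel 'I_N) : {vspace sl K N} :=
  lker (linfun (fun x : sl K N => \matrix_(r, c) (if S r c then 0 else vsval x r c))).

Lemma mem_sl_supp S x :
  x \in sl_supp S <-> forall r c, ~~ S r c -> vsval x r c = 0.
Proof.
pose F0 (y : sl K N) : 'M[K]_N := \matrix_(r, c) (if S r c then 0 else vsval y r c).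
have lin : linear F0.
  move=> a u v; apply/matrixP => r c; rewrite !mxE.
  by case: ifP; rewrite ?mulr0 ?addr0.
pose F : {linear sl K N -> 'M[K]_N} := HB.pack F0 (GRing.isLinear.Build _ _ _ _ F0 lin).
rewrite memv_ker (lfunE F) /= /F0; split=> [/eqP/matrixP E r c Src|E].
  by have := E r c; rewrite !mxE (negPf Src).
by apply/eqP/matrixP => r c; rewrite !mxE; case: ifPn => // /E.
Qed.

End SlLie.

(** * Simplicity of [sl_N] *)

Section SlSimple.
Variables (K : numFieldType) (N : nat).
Hypothesis N2 : (1 < N)%N.

Lemma lie_ideal_memP (L : finLieAlgType K) (U : {vspace L}) :
  lie_ideal U -> forall x y, y \in U -> [lie x, y] \in U.
Proof. by move=> /lie_span_subP h x y yU; apply: h => //; exact: memvf. Qed.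

(** An off-diagonal entry [x r c] is isolated by [ad(E c r)^2 x = -2 (x r c) E c r]. If [x] is
    diagonal with two distinct entries, [[E r c, x]] is a nonzero multiple of [E r c]. Otherwise [x]
    is scalar, and its zero trace makes it zero in characteristic 0. *)
Lemma sl_ideal_elem (U : {vspace sl K N}) (x : sl K N) : lie_ideal U ->
  x \in U -> x != 0 -> exists r c, r != c /\ elem_sl K r c \in U.
Proof.
move=> /lie_ideal_memP idU xU x0.
have [[r [c [rc xrc]]]|diag] := pselect (exists r c, r != c /\ vsval x r c != 0).
  exists c, r; rewrite eq_sym; split=> //.
  have : [lie elem_sl K c r, [lie elem_sl K c r, x]] \in U by rewrite !idU.
  have cr : c != r by rewrite eq_sym.
  have -> : [lie elem_sl K c r, [lie elem_sl K c r, x]] = (- 2 * vsval x r c) *: elem_sl K c r.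
    rewrite lieC [X in [lie X, _]]lieC lieNl opprK; apply: sl_ext => i j.
    rewrite !val_lie_elem // linearZ /= [RHS]mxE val_elem // mxE (negPf rc) (negPf cr).
    by case: (i == c); case: (j == r) => //=; ring.
  by rewrite rpredZeq mulf_eq0 oppr_eq0 pnatr_eq0 (negPf xrc).
have off r c : r != c -> vsval x r c = 0.
  by move=> rc; apply/eqP; apply: contrapT => /negP xrc; apply: diag; exists r, c.
have [[r [c xrc]]|const] := pselect (exists r c, vsval x r r != vsval x c c).
  exists r, c; have rc : r != c by apply: contra xrc => /eqP ->.
  split=> //; have : [lie elem_sl K r c, x] \in U by exact: idU.
  rewrite lieC memvN.
  have -> : [lie x, elem_sl K r c] = (vsval x r r - vsval x c c) *: elem_sl K r c.
    apply: sl_ext => i j; rewrite val_lie_elem // linearZ /= mxE val_elem // mxE.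
    have [->|ir] := eqVneq i r; have [->|jc] := eqVneq j c; rewrite //=; try ring.
    - by rewrite mulr0 sub0r mul1r off 1?eq_sym // mulr0 oppr0.
    - by rewrite off //; ring.
  by rewrite rpredZeq subr_eq0 (negPf xrc).
case/eqP: x0; apply: sl_ext => r c; rewrite linear0 mxE.
have [<-{c}|/off//] := eqVneq r c.
have := sl_trace x; rewrite /mxtrace (eq_bigr (fun=> vsval x r r)); last first.
  by move=> i _; apply/eqP; apply: contrapT => /negP h; apply: const; exists i, r.
rewrite sumr_const card_ord => /eqP.
by rewrite mulrn_eq0 eqn0Ngt (ltnW N2) => /eqP.
Qed.

Lemma sl_lie_simple : lie_simple (sl K N).
Proof.
split=> [/lie_span0P h|U idU].
  pose i0 : 'I_N := Ordinal (ltnW N2); pose i1 : 'I_N := Ordinal N2.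
  have := h (elem_sl K i0 i1) (elem_sl K i1 i0) (memvf _) (memvf _).
  rewrite lie_elem_opp // => /(congr1 vsval); rewrite val_elem_diag => /matrixP/(_ i0 i0).
  by rewrite linear0 !mxE eqxx /= subr0 => /eqP; rewrite oner_eq0.
have [->|U0] := eqVneq U 0%VS; [by left|right].
have [r [c [rc rcU]]] := sl_ideal_elem idU (memv_pick U) (etrans (congr1 negb (vpick0 U)) U0).
have inr i j k : i != j -> elem_sl K i j \in U -> i != k -> elem_sl K i k \in U.
  move=> ij ijU ik; have [<-//|jk] := eqVneq j k.
  by rewrite -(lie_elem K ij jk ik) lieC memvN (lie_ideal_memP idU).
have inl i j k : i != j -> elem_sl K i j \in U -> k != j -> elem_sl K k j \in U.
  move=> ij ijU kj; have [->//|ki] := eqVneq k i.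
  by rewrite -(lie_elem K ki ij kj) (lie_ideal_memP idU).
have elU a b : a != b -> elem_sl K a b \in U.
  move=> ab; have [ac|ac] := eqVneq a c; last first.
    by apply: (inr _ c) => //; apply: (inl r).
  have [br|br] := eqVneq b r; last first.
    by apply: (inl r) => //; [rewrite eq_sym|apply: (inr _ c) => //; rewrite eq_sym].
  (* For [N = 2] the transposed position cannot be reached by changing one index at a time, hence
     the double bracket [ad(E c r)^2 (E r c) = -2 E c r]. *)
  have crU : elem_sl K c r \in U.
    have := lie_ideal_memP idU (elem_sl K c r) (lie_ideal_memP idU (elem_sl K c r) rcU).
    have cr : c != r by rewrite eq_sym.
    rewrite (lie_elem_opp K cr).
    have -> : [lie elem_sl K c r, elem_diag K c r] = (- 2%:R) *: elem_sl K c r.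
      apply: sl_ext => i j; rewrite lieC sl_entryN sl_entryZ val_lie_elem //.
      rewrite val_elem_diag (val_elem K cr) !mxE !eqxx (negPf rc) (negPf cr).
      by case: (i == c); case: (j == r); case: (i == r); case: (j == c); rewrite /=; ring.
    by rewrite rpredZeq oppr_eq0 pnatr_eq0.
  by rewrite ac br.
apply/eqP; rewrite eqEsubv subvf; apply/subvP => x _.
rewrite [x](sl_sum_elem x r) memvD //; apply: memv_suml => i _.
  by apply: memv_suml => j ji; rewrite memvZ // elU // eq_sym.
have [->|ir] := eqVneq i r.
  rewrite (_ : elem_diag K r r = 0) ?scaler0 ?mem0v //.
  by apply: subvs_inj; rewrite val_elem_diag subrr linear0.
by rewrite memvZ // -lie_elem_opp // (lie_ideal_memP idU) // elU // eq_sym.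
Qed.

End SlSimple.

(** * Gradings of [sl_N] defined by a degree function on the indices *)

Section SlGrading.
Variables (K : fieldType) (N : nat) (deg : 'I_N -> int).
Implicit Types (x y : sl K N) (P : pred int).

Definition sl_gr (p : int) : {vspace sl K N} :=
  sl_supp K (fun r c => deg r - deg c == p).

(** All diagonal entries have degree 0, so they are kept or dropped together and the trace stays
    zero. With [pred1 p] this is the projection to one degree; with a comparison it is a
    truncation. *)
Definition sl_cut P x : sl K N :=
  to_sl (\matrix_(r, c) (if P (deg r - deg c) then vsval x r c else 0)).

Lemma sl_cutE P x r c :
  vsval (sl_cut P x) r c = if P (deg r - deg c) then vsval x r c else 0.
Proof.
rewrite to_slK ?mxE // /mxtrace.
under eq_bigr do rewrite mxE subrr.
by case: (P 0); [exact: sl_trace|rewrite big1].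
Qed.

Fact sl_cut_is_linear P : linear (sl_cut P).
Proof.
move=> a x y; apply: sl_ext => r c; rewrite !(sl_entryD, sl_entryZ, sl_cutE).
by case: ifP; rewrite ?mulr0 ?addr0.
Qed.
HB.instance Definition _ P :=
  GRing.isLinear.Build K (sl K N) (sl K N) *:%R (sl_cut P) (sl_cut_is_linear P).

Lemma sl_cut_id P p x : x \in sl_gr p -> P p -> sl_cut P x = x.
Proof.
move=> /mem_sl_supp xp Pp; apply: sl_ext => r c; rewrite sl_cutE.
by case: eqP (xp r c) => [->|_ ->] //; rewrite ?Pp // if_same.
Qed.

Lemma sl_cut0 P p x : x \in sl_gr p -> ~~ P p -> sl_cut P x = 0.
Proof.
move=> /mem_sl_supp xp Pp; apply: sl_ext => r c; rewrite sl_cutE sl_entry0.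
by case: eqP (xp r c) => [->|_ ->] //; rewrite ?(negPf Pp) // if_same.
Qed.

Lemma sl_cut1_gr p x : sl_cut (pred1 p) x \in sl_gr p.
Proof. by apply/mem_sl_supp => r c /negPf rc; rewrite sl_cutE /= rc. Qed.

Definition sl_degs : seq int := undup [seq deg r - deg c | r <- enum 'I_N, c <- enum 'I_N].

Lemma mem_sl_degs r c : deg r - deg c \in sl_degs.
Proof. by rewrite mem_undup; apply/allpairsP; exists (r, c); rewrite !mem_enum. Qed.

Lemma sl_cut_sum (s : seq int) x : uniq s -> {subset sl_degs <= s} ->
  x = \sum_(p <- s) sl_cut (pred1 p) x.
Proof.
move=> us sub; apply: sl_ext => r c; rewrite linear_sum /= summxE.
rewrite (bigD1_seq (deg r - deg c)) ?sub ?mem_sl_degs //=.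
rewrite sl_cutE /= eqxx big1 ?addr0 // => p pd.
by rewrite sl_cutE /= eq_sym (negPf pd).
Qed.

Lemma sl_gr_lie p q x y : x \in sl_gr p -> y \in sl_gr q -> [lie x, y] \in sl_gr (p + q).
Proof.
move=> /mem_sl_supp xp /mem_sl_supp yq; apply/mem_sl_supp => r c rc.
rewrite val_lieE big1 // => k _.
have xy0 : vsval x r k * vsval y k c = 0.
  have [E|/xp ->] := boolP (deg r - deg k == p); last by rewrite mul0r.
  by rewrite yq ?mulr0 //; lia.
have yx0 : vsval y r k * vsval x k c = 0.
  have [E|/yq ->] := boolP (deg r - deg k == q); last by rewrite mul0r.
  by rewrite xp ?mulr0 //; lia.
by rewrite xy0 yx0 subr0.
Qed.

Lemma sl_gr_elem r c : r != c -> elem_sl K r c \in sl_gr (deg r - deg c).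
Proof.
move=> rc; apply/mem_sl_supp => i j ij; rewrite val_elem // mxE.
by have [ir|//] := eqVneq i r; have [jc|//] := eqVneq j c; rewrite ir jc eqxx in ij.
Qed.

Lemma sl_is_gla : is_gla (vgrading sl_gr).
Proof.
apply: (is_gla_proj (pr := fun p => sl_cut (pred1 p)) (s0 := sl_degs)).
- by move=> p; exact: linearP.
- by move=> p x; exact: sl_cut1_gr.
- by move=> p x xp; apply: (sl_cut_id xp) => /=.
- by move=> p q x pq xq; apply: (sl_cut0 xq) => /=; rewrite eq_sym.
- by move=> x; apply: sl_cut_sum; rewrite ?undup_uniq.
- by move=> p q x y; exact: sl_gr_lie.
Qed.

End SlGrading.

(** * Cartan subalgebra, simple roots and coroots of [sl_(l+1)] *)

Section SlCartan.
Variables (K : numFieldType) (l : nat).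
Local Notation N := l.+1.
Implicit Types (x y : sl K N).

Definition sl_diag : {vspace sl K N} := sl_supp K (fun r c => r == c).

Lemma sl_diag_lie x y r c : y \in sl_diag ->
  vsval [lie x, y] r c = vsval x r c * (vsval y c c - vsval y r r).
Proof.
move=> /mem_sl_supp yh; rewrite val_lieE sumrB (bigD1 c) //= big1 ?addr0 => [|k kc]; last first.
  by rewrite yh // mulr0.
rewrite (bigD1 r) //= big1 ?addr0 => [|k kr]; last by rewrite yh ?mul0r // eq_sym.
by rewrite mulrBr [in X in _ - X]mulrC.
Qed.

Lemma sl_diag_elem_diag r c : elem_diag K r c \in sl_diag.
Proof.
apply/mem_sl_supp => i j ij; rewrite val_elem_diag !mxE.
have H k : (i == k) && (j == k) = false.
  by apply/negP => /andP[/eqP ik /eqP jk]; rewrite ik jk eqxx in ij.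
by rewrite !H subrr.
Qed.

Lemma sl_cartan (deg : 'I_N -> int) : cartan_subalgebra sl_diag (sl_gr K deg 0).
Proof.
have hh x y : x \in sl_diag -> y \in sl_diag -> [lie x, y] = 0.
  move=> /mem_sl_supp xh yh; apply: sl_ext => r c; rewrite sl_diag_lie // sl_entry0.
  by have [->|/xh ->] := eqVneq r c; rewrite ?subrr ?mulr0 ?mul0r.
split.
- apply/subvP => x /mem_sl_supp xh; apply/mem_sl_supp => r c rc.
  by apply: xh; apply: contra rc => /eqP ->; rewrite subrr.
- by apply/lie_span_subP => x y xh yh; rewrite hh // mem0v.
- by exists 1%N; apply/lie_span0P => x y; exact: hh.
- move=> x _ xn; apply/mem_sl_supp => r c rc.
  (* The bracket with [elem_diag r c] multiplies the entry [(r, c)] by -2, and for a normalizing [x]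
     the result must be diagonal. *)
  have /mem_sl_supp/(_ r c rc)/eqP := xn _ (sl_diag_elem_diag r c).
  rewrite sl_diag_lie ?sl_diag_elem_diag // val_elem_diag !mxE !eqxx.
  rewrite [c == r]eq_sym (negPf rc) /= mulf_eq0 => /orP[/eqP//|].
  by rewrite sub0r subr0 -opprD oppr_eq0 (pnatr_eq0 K 2).
Qed.

Local Notation h := sl_diag.
Local Notation dual := ('Hom(subvs_of h, K^o)).

Definition entry_fun (r : 'I_N) (t : subvs_of h) : K^o := vsval (vsval t) r r.

Fact entry_fun_linear r : linear (entry_fun r).
Proof. move=> a t u; rewrite /entry_fun.
by rewrite (_ : vsval (a *: t + u) = a *: vsval t + vsval u) ?sl_entryD ?sl_entryZ // linearP. Qed.
HB.instance Definition _ r :=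
  GRing.isLinear.Build K (subvs_of h) K^o *:%R (entry_fun r) (entry_fun_linear r).

Definition eps (r : 'I_N) : dual := linfun (entry_fun r).

Lemma epsE r t : eps r t = vsval (vsval t) r r.
Proof. by rewrite lfunE. Qed.

Definition ord_lo (i : 'I_l) : 'I_N := widen_ord (leqnSn l) i.
Definition ord_hi (i : 'I_l) : 'I_N := lift ord0 i.

Lemma ord_hiE i : ord_hi i = i.+1 :> nat.
Proof. by []. Qed.

Lemma ord_lo_neq_hi i : ord_lo i != ord_hi i.
Proof. by rewrite -val_eqE /= /bump /= neq_ltn ltnSn. Qed.

Definition sroot (i : 'I_l) : dual := eps (ord_lo i) - eps (ord_hi i).

Lemma srootE i t : sroot i t = vsval (vsval t) (ord_lo i) (ord_lo i)
  - vsval (vsval t) (ord_hi i) (ord_hi i).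
Proof. by rewrite add_lfunE opp_lfunE !epsE. Qed.

(** The mean is subtracted to make the matrix traceless; roots see only differences of entries, so
    their values are those of [c]. *)
Definition to_diag (c : 'I_N -> K) : subvs_of h :=
  vsproj h (to_sl (diag_mx (\row_i c i) - ((\sum_i c i) / N%:R)%:M)).

Lemma to_diagE c r : vsval (vsval (to_diag c)) r r = c r - (\sum_i c i) / N%:R.
Proof.
have tr : \tr (diag_mx (\row_i c i) - ((\sum_i c i) / N%:R)%:M : 'M[K]_N) = 0.
  rewrite linearB /= mxtrace_diag mxtrace_scalar -[X in _ - X]mulr_natr divfK ?pnatr_eq0 //.
  by apply/eqP; rewrite subr_eq0; apply/eqP; apply: eq_bigr => j _; rewrite mxE.
have hm : to_sl (diag_mx (\row_i c i) - ((\sum_i c i) / N%:R)%:M) \in h.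
  by apply/mem_sl_supp => i j ij; rewrite to_slK // !mxE (negPf ij) subrr.
by rewrite /to_diag (vsprojK hm) to_slK // !mxE eqxx.
Qed.

(** If all simple roots vanish, consecutive diagonal entries agree, the matrix is scalar, and its
    trace excludes a nonzero scalar. *)
Lemma diag_ext (t u : subvs_of h) : (forall i, sroot i t = sroot i u) -> t = u.
Proof.
move=> tu; pose s := t - u.
have s0 i : sroot i s = 0 by rewrite linearB /= tu subrr.
have sc k (kN : (k < N)%N) : vsval (vsval s) (Ordinal kN) (Ordinal kN) = vsval (vsval s) ord0 ord0.
  elim: k kN => [|k IH] kN; first by have -> : Ordinal kN = ord0 by exact: val_inj.
  rewrite -(IH (ltnW kN)); apply/eqP; rewrite eq_sym -subr_eq0.
  have := s0 (Ordinal (kN : (k < l)%N)); rewrite srootE => /eqP.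
  have -> : ord_lo (Ordinal (kN : (k < l)%N)) = Ordinal (ltnW kN) by exact: val_inj.
  by have -> : ord_hi (Ordinal (kN : (k < l)%N)) = Ordinal kN by exact: val_inj.
apply/eqP; rewrite -subr_eq0 -/s; apply/eqP; apply: subvs_inj; rewrite linear0.
apply: sl_ext => r c; rewrite sl_entry0; have [<-{c}|rc] := eqVneq r c; last first.
  by have /mem_sl_supp -> := subvsP s.
have := sl_trace (vsval s); rewrite /mxtrace (eq_bigr (fun=> vsval (vsval s) ord0 ord0)); last first.
  by move=> [i iN] _; exact: sc.
rewrite sumr_const card_ord => /eqP; rewrite mulrn_eq0 /= => /eqP E.
by case: r => r rN; rewrite sc.
Qed.

(** The fundamental coweights, dual to the simple roots: evaluation on them gives the coefficients
    of any functional. *)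
Definition fcoweight (j : 'I_l) : subvs_of h := to_diag (fun r => (r <= j)%:R).

Lemma sroot_fcoweight i j : sroot i (fcoweight j) = (i == j)%:R.
Proof.
rewrite srootE !to_diagE opprB addrA subrK /= /bump /=.
rewrite -val_eqE /= add1n; case: (ltngtP i j) => ij //=; rewrite ?subrr ?subr0 //.
Qed.

Lemma dual_decomp (b : dual) : b = \sum_i b (fcoweight i) *: sroot i.
Proof.
apply/lfunP => t; rewrite {1}(_ : t = \sum_i sroot i t *: fcoweight i); last first.
  apply: diag_ext => k; rewrite linear_sum /= (bigD1 k) //= linearZ /= sroot_fcoweight eqxx.
  rewrite big1 ?addr0 => [|i ik]; first by rewrite [_ *: _]mulr1.
  by rewrite linearZ /= sroot_fcoweight eq_sym (negPf ik) scaler0.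
rewrite sum_lfunE linear_sum; apply: eq_bigr => i _.
by rewrite linearZ scale_lfunE /= [LHS]mulrC.
Qed.

Definition sroots : l.-tuple dual := [tuple sroot i | i < l].

Lemma sroots_basis : basis_of fullv sroots.
Proof.
apply/andP; split.
  rewrite eqEsubv subvf; apply/subvP => b _; rewrite (dual_decomp b).
  by apply: memv_suml => i _; rewrite memvZ // memv_span // -[sroot i](tnth_mktuple sroot) mem_tnth.
apply/freeP => c E i.
have {}E : \sum_j c j *: sroot j = 0.
  by rewrite -[RHS]E; apply: eq_bigr => j _; rewrite -tnth_nth tnth_mktuple.
have := congr1 (fun f : dual => f (fcoweight i)) E.
rewrite sum_lfunE zero_lfunE (bigD1 i) //= big1 => [|j ji].
  by rewrite addr0 scale_lfunE sroot_fcoweight eqxx [_ *: _]mulr1.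
by rewrite scale_lfunE sroot_fcoweight (negPf ji) scaler0.
Qed.

Lemma elem_root_space r c (b : dual) : r != c -> b = eps r - eps c ->
  in_root_space b (elem_sl K r c).
Proof.
move=> rc -> t; apply: sl_ext => i j; rewrite lieC sl_entryN sl_diag_lie ?subvsP //.
rewrite sl_entryZ add_lfunE opp_lfunE !epsE val_elem // mxE.
by case: eqP => [->|_]; case: eqP => [->|_] /=; ring.
Qed.

Lemma elem_neq0 r c : r != c -> elem_sl K r c != 0 :> sl K N.
Proof.
move=> rc; apply/eqP => /(congr1 (fun x : sl K N => vsval x r c)).
by rewrite sl_entry0 val_elem // mxE !eqxx => /eqP; rewrite oner_eq0.
Qed.

(** Any nonzero entry [(r, c)] of a root vector is an eigenvector entry with eigenvalue
    [eps r - eps c], which identifies the root. *)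
Lemma root_eps (b : dual) : is_root b -> exists r c, r != c /\ b = eps r - eps c.
Proof.
move=> [b0 [x x0 xb]].
have [r [c xrc]] : exists r c, vsval x r c != 0.
  apply: contrapT => H; case/eqP: x0; apply: sl_ext => r c; rewrite sl_entry0.
  by apply/eqP; apply: contrapT => /negP xrc; apply: H; exists r, c.
have E : b = eps r - eps c.
  apply/lfunP => t; have := congr1 (fun y : sl K N => vsval y r c) (xb t).
  rewrite /= lieC sl_entryN sl_diag_lie ?subvsP // sl_entryZ add_lfunE opp_lfunE !epsE.
  by rewrite -mulrN opprB mulrC => /(mulIf xrc) ->.
by exists r, c; split=> //; apply: contra b0 => /eqP rc; rewrite E rc subrr.
Qed.

Lemma eps_diff (r c : 'I_N) : (r <= c)%N ->
  eps r - eps c = \sum_(i < l) ((r <= i < c)%N)%:R *: sroot i.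
Proof.
move=> rc; rewrite [LHS]dual_decomp; apply: eq_bigr => i _; congr (_ *: _).
rewrite add_lfunE opp_lfunE !epsE !to_diagE opprB addrA subrK.
case: (leqP r i) => ri; case: (leqP c i) => ci; rewrite /= ?subrr ?subr0 //.
by move: (leq_trans rc ci); rewrite leqNgt ri.
Qed.

Lemma sl_simple_roots : simple_root_system sroots.
Proof.
split; first exact: sroots_basis.
- move=> i; rewrite tnth_mktuple; split.
    apply/eqP => /(congr1 (fun f : dual => f (fcoweight i))).
    by rewrite sroot_fcoweight eqxx zero_lfunE => /eqP; rewrite oner_eq0.
  exists (elem_sl K (ord_lo i) (ord_hi i)); first exact/elem_neq0/ord_lo_neq_hi.
  exact: elem_root_space (ord_lo_neq_hi i) _.
- move=> b /root_eps[r [c [_ ->]]].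
  case: (leqP r c) => [|/ltnW] rc.
    exists (fun i => (r <= i < c)%N); left; rewrite eps_diff //.
    by apply: eq_bigr => i _; rewrite tnth_mktuple.
  exists (fun i => (c <= i < r)%N); right; rewrite -opprB eps_diff //; congr (- _).
  by apply: eq_bigr => i _; rewrite tnth_mktuple.
Qed.

Definition scoroot (j : 'I_l) : subvs_of h :=
  vsproj h (elem_diag K (ord_lo j) (ord_hi j)).

Lemma val_scoroot j : vsval (scoroot j) = elem_diag K (ord_lo j) (ord_hi j).
Proof. by rewrite vsprojK // sl_diag_elem_diag. Qed.

Lemma sroot_scoroot i j : sroot i (scoroot j) = (cartan_matrix_A l i j)%:~R.
Proof.
rewrite srootE val_scoroot val_elem_diag !mxE !andbb.
have -> : (ord_lo i == ord_lo j) = (i == j) by [].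
have -> : (ord_lo i == ord_hi j) = (j.+1 == i :> nat) by rewrite eq_sym.
have -> : (ord_hi i == ord_lo j) = (i.+1 == j :> nat) by [].
have [<-|ij] := eqVneq i j; first by rewrite eqn_leq ltnn andFb /=; ring.
rewrite /=; case: eqP => [ij1|_]; case: eqP => [ij2|_]; first by lia.
all: by rewrite /=; ring.
Qed.

Lemma sl_coroots j : is_coroot (sroot j) (scoroot j).
Proof.
split; first by rewrite sroot_scoroot mxE eqxx.
exists (elem_sl K (ord_lo j) (ord_hi j)), (elem_sl K (ord_hi j) (ord_lo j)).
have lh := ord_lo_neq_hi j; have hl : ord_hi j != ord_lo j by rewrite eq_sym.
split; first exact: elem_root_space.
  by apply: elem_root_space; rewrite // opprB.
by rewrite val_scoroot lie_elem_opp.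
Qed.

End SlCartan.

(** * The block grading of [sl_(m+n+1)] and its type *)

Section SlType.
Variables (K : numFieldType) (m n : nat).
Local Notation N := (m + n).+1.

(* The indices are split into blocks of sizes m, 1, n. *)
Definition bdeg (r : 'I_N) : int := ((r < m) + (r <= m))%N%:Z.

Local Notation gr := (sl_gr K bdeg).

(** The index of the block of size 1. In degree -1 the row of [mid] will correspond to [e] and its
    column to [f]. *)
Definition mid : 'I_N := Ordinal (leq_addr n m : (m < N)%N).

Lemma sl_gr_span p (U : {vspace sl K N}) : p != 0 ->
  (forall r c, bdeg r - bdeg c = p -> elem_sl K r c \in U) -> (gr p <= U)%VS.
Proof.
move=> p0 hU; apply/subvP => x /mem_sl_supp xp.
rewrite [x](sl_sum_elem x mid) memvD //; apply: memv_suml => r _.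
  apply: memv_suml => c _; have [E|/xp ->] := eqVneq (bdeg r - bdeg c) p.
    by rewrite memvZ // hU.
  by rewrite scale0r mem0v.
by rewrite xp ?scale0r ?mem0v // subrr eq_sym.
Qed.

Lemma sl_gr_fundamental : (0 < m)%N -> fundamental gr.
Proof.
move=> m0; split=> [E|U /lie_span_subP Ulie gU p p0].
  have om : ord0 != mid by rewrite -val_eqE /= eq_sym -lt0n.
  have : elem_sl K mid ord0 \in gr (-1).
    have -> : -1 = bdeg mid - bdeg ord0 by rewrite /bdeg /= ltnn leqnn m0.
    by apply: sl_gr_elem; rewrite eq_sym.
  by rewrite E memv0 (negPf (elem_neq0 K _)) // eq_sym.
have [->|p1] := eqVneq p (-1); first by [].
apply: sl_gr_span => [|r c rc]; first by rewrite lt_eqF.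
(* Only degree -2 is left, with [r] in the last block and [c] in the first, where [E r c =
   [E r mid, E mid c]]. *)
have [rm cm] : (m < r)%N /\ (c < m)%N by move: rc p0 p1; rewrite /bdeg; lia.
have nq (i j : 'I_N) : (i < j)%N -> (i != j :> 'I_N) * (j != i :> 'I_N).
  by move=> ij; split; apply/eqP => E; rewrite E ltnn in ij.
have [rz zr] := nq mid r rm; have [cz zc] := nq c mid cm.
rewrite -(@lie_elem K N r mid c) ?(nq _ _ (ltn_trans cm rm)) //.
have d1 : bdeg r - bdeg mid = -1 by move: rm; rewrite /bdeg /=; lia.
have d2 : bdeg mid - bdeg c = -1 by move: cm; rewrite /bdeg /=; lia.
apply: Ulie; apply: (subvP gU).
  by rewrite -d1 sl_gr_elem.
by rewrite -d2 sl_gr_elem.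
Qed.

Lemma sl_simple_gla : (0 < m)%N -> (0 < n)%N ->
  simple_gla_of_type gr (cartan_matrix_A (m + n)) (roots_m_m1 m n).
Proof.
move=> m0 n0; split.
- exact: sl_is_gla.
- by apply: sl_lie_simple; rewrite ltnS addn_gt0 m0.
- exact: sl_gr_fundamental.
(* The grading element. A simple root takes the value 1 on it exactly where [bdeg] drops, that is,
   on both sides of the middle block; counted from 1 these are the roots number [m] and [m + 1]. *)
pose E : subvs_of (sl_diag K (m + n)) := to_diag (fun r => (bdeg r)%:~R : K).
have aE i : sroot K i E = ((i.+1 == m) || (i.+1 == m.+1))%:R.
  rewrite srootE !to_diagE opprB addrA subrK -rmorphB /= /bdeg ord_hiE /=.
  rewrite -[RHS]mulrz_nat; congr (_%:~R); lia.
exists (sl_diag K (m + n)), E, (sroots K (m + n)), (@scoroot K (m + n)); split.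
- exact: sl_cartan.
- move=> p x /mem_sl_supp xp; apply: sl_ext => r c; rewrite lieC sl_entryN sl_entryZ.
  rewrite sl_diag_lie ?subvsP // !to_diagE.
  have [E'|/xp ->] := eqVneq (bdeg r - bdeg c) p; last by rewrite mul0r oppr0 mulr0.
  by rewrite -E' rmorphB /=; ring.
- split; first exact: sl_simple_roots.
  by move=> i; rewrite tnth_mktuple aE ler0n.
- split=> [j|i j]; first by rewrite tnth_mktuple; exact: sl_coroots.
  by rewrite tnth_mktuple sroot_scoroot.
- apply/setP => i; rewrite !inE tnth_mktuple aE.
  by case: (_ || _); rewrite ?eqxx // eq_sym oner_eq0.
Qed.

End SlType.

(** * A filiform quotient *)

(* The semidirect product of the line K by K^d, on which it acts by the shift. *)
Definition filiform (K : fieldType) (d : nat) := (K^o * 'rV[K]_d)%type.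

HB.instance Definition _ (K : fieldType) (d : nat) := Vector.on (filiform K d).

Section Filiform.
Variables (K : fieldType) (d : nat).
Implicit Types x y z : filiform K d.

Definition shift_mx : 'M[K]_d := \matrix_(i, j) (j == i.+1 :> nat)%:R.

Definition fil_lie x y : filiform K d :=
  (0, x.1 *: (y.2 *m shift_mx) - y.1 *: (x.2 *m shift_mx)).

Fact fil_lie_linearl (a : K) x x' y :
  fil_lie (a *: x + x') y = a *: fil_lie x y + fil_lie x' y.
Proof.
congr pair => /=; first by rewrite scaler0 addr0.
by apply/rowP => i; rewrite mulmxDl -scalemxAl !mxE -[a *: x.1]/(a * x.1); ring.
Qed.

Fact fil_lie_linearr (a : K) x y y' :
  fil_lie x (a *: y + y') = a *: fil_lie x y + fil_lie x y'.
Proof.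
congr pair => /=; first by rewrite scaler0 addr0.
by apply/rowP => i; rewrite mulmxDl -scalemxAl !mxE -[a *: y.1]/(a * y.1); ring.
Qed.

Fact fil_liexx x : fil_lie x x = 0.
Proof. by congr pair; rewrite /= subrr. Qed.

Fact fil_jacobi x y z :
  fil_lie x (fil_lie y z) + fil_lie y (fil_lie z x) + fil_lie z (fil_lie x y) = 0.
Proof.
congr pair => /=; first by rewrite !addr0.
by apply/rowP => i; rewrite !(mulmxBl, scale0r, subr0) -!scalemxAl !mxE; ring.
Qed.

HB.instance Definition _ := Lmodule_isLieAlgebra.Build K (filiform K d)
  fil_lie_linearl fil_lie_linearr fil_liexx fil_jacobi.

Lemma fil_lieE x y :
  [lie x, y] = (0, x.1 *: (y.2 *m shift_mx) - y.1 *: (x.2 *m shift_mx)) :> filiform K d.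
Proof. by []. Qed.

(** This is zero for [k >= d], so that the shift rule [fv_shift] holds for every [k]. *)
Definition fv (k : nat) : 'rV[K]_d := \row_i (i == k :> nat)%:R.

Lemma fv_shift k : fv k *m shift_mx = fv k.+1.
Proof.
apply/rowP => i; rewrite !mxE; have [kd|kd] := ltnP k d.
  rewrite (bigD1 (Ordinal kd)) //= !mxE eqxx mul1r big1 ?addr0 // => j jk.
  by rewrite !mxE (_ : (j == k :> nat) = false) ?mul0r //; apply: negPf.
rewrite big1 => [|j _]; last by rewrite !mxE ltn_eqF ?mul0r // (leq_trans (ltn_ord j)).
by rewrite ltn_eqF // (leq_trans (ltn_ord i)) // ltnW.
Qed.

Definition fil_a : filiform K d := (1, 0).
Definition fil_v (k : nat) : filiform K d := (0, fv k).

Lemma fil_lie_av k : [lie fil_a, fil_v k] = fil_v k.+1.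
Proof. by rewrite fil_lieE /= scale1r fv_shift scale0r subr0. Qed.

Lemma fil_lie_vv k k' : [lie fil_v k, fil_v k'] = 0.
Proof. by rewrite fil_lieE /= !scale0r subr0. Qed.

Lemma fil_v_neq0 k : (k < d)%N -> fil_v k != 0.
Proof.
move=> kd; apply/eqP => /(congr1 (fun x : filiform K d => x.2 ord0 (Ordinal kd))).
by rewrite !mxE eqxx => /eqP; rewrite oner_eq0.
Qed.

Lemma fil_sum I (r : seq I) (F : I -> filiform K d) :
  \sum_(i <- r) F i = (\sum_(i <- r) (F i).1, \sum_(i <- r) (F i).2).
Proof. by elim/big_rec3: _ => // i x1 x2 x3 _ ->; case: (F i). Qed.

Lemma fil_decomp x : x = x.1 *: fil_a + \sum_(i < d) x.2 ord0 i *: fil_v i.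
Proof.
rewrite fil_sum; case: x => s u; congr pair; rewrite /=.
  rewrite big1 ?addr0 => [|i _]; last by rewrite scaler0.
  by rewrite [RHS]mulr1.
rewrite scaler0 add0r; apply/rowP => j; rewrite summxE (bigD1 j) //= !mxE eqxx mulr1.
rewrite big1 ?addr0 // => i ij; rewrite !mxE (_ : (j == i :> nat) = false) ?mulr0 //.
by rewrite eq_sym; apply: negPf.
Qed.

(** The grading puts both [fil_a] and [fil_v 0] in degree -1 and [fil_v i] in degree [-(i+1)], so
    that the kind is [d]. *)
Definition fil_pr (p : int) x : filiform K d :=
  (if p == - 1 then x.1 else 0, \row_i (if p == - i.+1%:Z then x.2 ord0 i else 0)).

Fact fil_pr_linear p : linear (fil_pr p).
Proof.
move=> a x y; congr pair => /=; first by case: ifP; rewrite ?scaler0 ?addr0.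
by apply/rowP => i; rewrite !mxE; case: ifP; rewrite ?mulr0 ?addr0.
Qed.
HB.instance Definition _ p :=
  GRing.isLinear.Build K (filiform K d) (filiform K d) *:%R (fil_pr p) (fil_pr_linear p).

Definition fil_gr (p : int) : {vspace filiform K d} := lker (linfun (fil_pr p) - \1)%VF.

Lemma mem_fil_gr p x : (x \in fil_gr p) = (fil_pr p x == x).
Proof. by rewrite memv_ker add_lfunE opp_lfunE id_lfunE lfunE subr_eq0. Qed.

Lemma fil_a_gr : fil_a \in fil_gr (-1).
Proof.
rewrite mem_fil_gr; apply/eqP; congr pair; rewrite /= ?eqxx //.
by apply/rowP => i; rewrite !mxE if_same.
Qed.

Lemma fil_v_gr k : fil_v k \in fil_gr (- k.+1%:Z).
Proof.
rewrite mem_fil_gr; apply/eqP; congr pair; rewrite /= ?if_same //.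
apply/rowP => i; rewrite !mxE; have [->|ik] := eqVneq (i : nat) k; first by rewrite eqxx.
by rewrite if_same.
Qed.

Lemma fil_gr0 p x : x \in fil_gr p -> p != -1 -> x.1 = 0.
Proof. by rewrite mem_fil_gr => /eqP <- /negPf /= ->. Qed.

Lemma fil_gr_v p x (i : 'I_d) : x \in fil_gr p -> p != - i.+1%:Z -> x.2 ord0 i = 0.
Proof. by rewrite mem_fil_gr => /eqP <- /negPf pi; rewrite mxE pi. Qed.

Lemma mem_fil_grP p x : (p != -1 -> x.1 = 0) ->
  (forall i : 'I_d, p != - i.+1%:Z -> x.2 ord0 i = 0) -> x \in fil_gr p.
Proof.
move=> h1 h2; rewrite mem_fil_gr; apply/eqP; rewrite [RHS]surjective_pairing; congr pair => /=.
  by case: ifPn => // /h1.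
by apply/rowP => i; rewrite mxE; case: ifPn => // /h2.
Qed.

Lemma fil_is_gla : is_gla (vgrading fil_gr).
Proof.
(* The list has [d.+1] entries, so that the degree -1 of [fil_a] is present even for [d = 0]. *)
apply: (is_gla_proj (pr := fil_pr) (s0 := [seq - i.+1%:Z | i <- iota 0 d.+1])).
- by move=> p; exact: linearP.
- move=> p x; rewrite mem_fil_gr; apply/eqP; congr pair => /=; first by case: (p == -1).
  by apply/rowP => i; rewrite !mxE; case: (p == _).
- by move=> p x; rewrite mem_fil_gr => /eqP.
- move=> p q x pq; rewrite mem_fil_gr => /eqP <-; congr pair => /=.
    by case: eqP => // <-; rewrite [q == p]eq_sym (negPf pq).
  by apply/rowP => i; rewrite !mxE; case: eqP => // <-; rewrite eq_sym (negPf pq).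
- move=> x; have us : uniq [seq - i.+1%:Z | i <- iota 0 d.+1].
    by rewrite map_inj_uniq ?iota_uniq // => i j /=; lia.
  rewrite fil_sum [LHS]surjective_pairing; congr pair => /=.
    have m1 : -1 \in [seq - i.+1%:Z | i <- iota 0 d.+1] by rewrite mem_head.
    by rewrite (bigD1_seq (-1)) //= big1 ?addr0 // => i /negPf ->.
  apply/rowP => i; have mi : - i.+1%:Z \in [seq - i.+1%:Z | i <- iota 0 d.+1].
    by apply/mapP; exists (i : nat) => //; rewrite mem_iota /= add0n ltnS ltnW.
  rewrite summxE (bigD1_seq (- i.+1%:Z)) //= mxE eqxx big1 ?addr0 // => p.
  by rewrite mxE => /negPf ->.
- move=> p q x y xp yq; apply: mem_fil_grP => // i pqi.
  have sh r z : z \in fil_gr r -> r - 1 != - i.+1%:Z -> (z.2 *m shift_mx) ord0 i = 0.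
    move=> zr ri; rewrite mxE big1 // => j _; rewrite !mxE.
    have [ij|_] := eqVneq (i : nat) j.+1; last by rewrite mulr0.
    by rewrite (fil_gr_v zr) ?mul0r //; move: ri; rewrite ij; lia.
  rewrite mxE [X in X + _]mxE [X in _ + X]mxE [X in - X]mxE; have -> : x.1 * (y.2 *m shift_mx) ord0 i = 0.
    have [p1|/(fil_gr0 xp) ->] := eqVneq p (-1); last by rewrite mul0r.
    by rewrite (sh _ _ yq) ?mulr0 //; move: pqi; rewrite p1 addrC.
  rewrite sub0r; have [q1|/(fil_gr0 yq) ->] := eqVneq q (-1); last by rewrite mul0r oppr0.
  by rewrite (sh _ _ xp) ?mulr0 ?oppr0 //; move: pqi; rewrite q1.
Qed.

Lemma fil_mem_sub (U : {vspace filiform K d}) : lie_subalgebra U ->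
  fil_a \in U -> fil_v 0 \in U -> U = fullv.
Proof.
move=> /lie_span_subP Ulie aU vU.
have vkU k : fil_v k \in U by elim: k => // k IH; rewrite -fil_lie_av Ulie.
apply/eqP; rewrite eqEsubv subvf; apply/subvP => x _; rewrite (fil_decomp x).
by rewrite memvD ?memvZ //; apply: memv_suml => i _; rewrite memvZ.
Qed.

Hypothesis d1 : (0 < d)%N.

Lemma fil_gr_m1 : fil_gr (-1) = (<[fil_a]> + <[fil_v 0]>)%VS.
Proof.
apply/eqP; rewrite eqEsubv; apply/andP; split; apply/subvP => x.
  move=> xg; rewrite (fil_decomp x) (bigD1 (Ordinal d1)) //= big1 ?addr0 => [|i i0].
    by rewrite memv_add // memvZ // memv_line.
  by rewrite (fil_gr_v xg) ?scale0r //; move: i0; rewrite -val_eqE /=; lia.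
case/memv_addP => _ /vlineP[a ->] [_ /vlineP[b ->] ->].
by rewrite memvD // memvZ // ?fil_a_gr // (fil_v_gr 0).
Qed.

Lemma fil_a_neq0 : fil_a != 0.
Proof. by apply/eqP => /(congr1 fst) /eqP; rewrite oner_eq0. Qed.

Lemma fil_of_kind : of_kind fil_gr d.
Proof.
split=> [E|p pd].
  have := fil_v_gr d.-1; rewrite prednK // E memv0.
  by rewrite (negPf (fil_v_neq0 _)) // ltn_predL.
apply/eqP; rewrite -subv0; apply/subvP => x xp; rewrite memv0.
apply/eqP; rewrite (fil_decomp x) (fil_gr0 xp); last by move: pd d1; lia.
rewrite scale0r add0r big1 // => i _; rewrite (fil_gr_v xp) ?scale0r //.
by move: pd (ltn_ord i); lia.
Qed.

Lemma fil_pseudo_product : pseudo_product_fgla fil_gr <[fil_a]>%VS <[fil_v 0]>%VS.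
Proof.
have line0 (x : filiform K d) : [lie x, x] = 0 -> lie_span <[x]> <[x]> = 0%VS.
  move=> x0; apply/lie_span0P => _ _ /vlineP[a ->] /vlineP[b ->].
  by rewrite lieZl linearZ /= x0 !scaler0.
have nz (x : filiform K d) : x != 0 -> <[x]>%VS <> 0%VS.
  by move=> /negPf x0 E; have := memv_line x; rewrite E memv0 x0.
split; [split|split| |].
- exact: fil_is_gla.
- move=> p p0; apply/eqP; rewrite -subv0; apply/subvP => x xp; rewrite memv0.
  apply/eqP; rewrite (fil_decomp x) (fil_gr0 xp); last by lia.
  by rewrite scale0r add0r big1 // => i _; rewrite (fil_gr_v xp) ?scale0r //; lia.
- split=> [E|U Ulie]; first by have := fil_a_gr; rewrite E memv0 (negPf fil_a_neq0).
  move=> gU p _; rewrite (fil_mem_sub Ulie) ?subvf // (subvP gU) ?fil_a_gr //.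
  exact: (fil_v_gr 0).
- exact/nz/fil_a_neq0.
- exact/nz/fil_v_neq0.
- by rewrite fil_gr_m1.
- apply/eqP; rewrite -subv0; apply/subvP => x /memv_capP[/vlineP[a ->] /vlineP[b E]].
  have /= := congr1 fst E; rewrite scaler0 => /eqP; rewrite [_ *: _]mulr1 => /eqP ->.
  by rewrite scale0r mem0v.
- by apply: line0; rewrite liexx.
- by apply: line0; rewrite liexx.
Qed.

End Filiform.

(** * Maps of the free algebra onto the filiform one *)

Section FreeQuotient.
Variables (K : fieldType) (M : finLieAlgType K) (gM : int -> {vspace M}) (e f : {vspace M}).

Lemma pseudo_product_sym : pseudo_product_fgla gM e f -> pseudo_product_fgla gM f e.
Proof. by move=> [? [e0 f0 ef ef0] ee ff]; split=> //; split=> //; rewrite 1?addvC 1?capvC. Qed.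

Variables (m n mu : nat).

(** The universal property is applied to [x |-> xi x *: fil_a + eta x *: fil_v 0]. The vectors [a]
    and [b] on which [xi] and [eta] do not vanish make this map onto in degree -1. *)
Lemma free_quotient_filiform (xi eta : {linear M -> K^o}) :
    free_pseudo_product_fgla gM e f m n mu ->
    (forall x, x \in f -> xi x = 0) -> (forall x, x \in e -> eta x = 0) ->
    (exists2 a, a \in e & xi a != 0) -> (exists2 b, b \in f & eta b != 0) ->
  exists psi : {linear M -> filiform K mu},
    [/\ lie_hom psi, forall p x, x \in gM p -> psi x \in fil_gr K mu p,
        forall a, a \in e -> psi a = xi a *: fil_a K mu &
        forall b, b \in f -> psi b = eta b *: fil_v K mu 0].
Proof.
move=> [[_ [_ _ gef _] _ _] [mu2 _] _ univ] xif etae [a ae xa] [b bf eb].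
have mu0 : (0 < mu)%N by exact: ltnW.
pose phi0 x : filiform K mu := (xi x : K) *: fil_a K mu + (eta x : K) *: fil_v K mu 0.
have phil : linear phi0.
  by move=> c x y; rewrite /phi0 (linearP xi) (linearP eta) !scalerDl scalerDr !scalerA addrACA.
pose phi := linfun (HB.pack phi0 (GRing.isLinear.Build _ _ _ _ phi0 phil) : {linear M -> filiform K mu}).
have phiE x : phi x = (xi x : K) *: fil_a K mu + (eta x : K) *: fil_v K mu 0 by rewrite lfunE.
have phie x : x \in e -> phi x = (xi x : K) *: fil_a K mu.
  by move=> xe; rewrite phiE etae // scale0r addr0.
have phif x : x \in f -> phi x = (eta x : K) *: fil_v K mu 0.
  by move=> xf; rewrite phiE xif // scale0r add0r.
have phi1 : (phi @: e <= <[fil_a K mu]>)%VS.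
  by apply/subvP => _ /memv_imgP[x xe ->]; rewrite phie // memvZ // memv_line.
have phi2 : (phi @: f <= <[fil_v K mu 0]>)%VS.
  by apply/subvP => _ /memv_imgP[x xf ->]; rewrite phif // memvZ // memv_line.
have phig : (phi @: gM (-1))%VS = fil_gr K mu (-1).
  rewrite -gef limgD fil_gr_m1 //; congr (_ + _)%VS; apply/eqP; rewrite eqEsubv ?phi1 ?phi2 /=.
    rewrite -memvE; apply/memv_imgP; exists ((xi a)^-1 *: a); first by rewrite memvZ.
    by rewrite linearZ /= phie // scalerA mulVf // scale1r.
  rewrite -memvE; apply/memv_imgP; exists ((eta b)^-1 *: b); first by rewrite memvZ.
  by rewrite linearZ /= phif // scalerA mulVf // scale1r.
have [psi [[[psihom psig _] psiphi] _]] :=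
  univ _ _ _ _ (fil_pseudo_product K mu0) (fil_of_kind K mu0) phi phig phi1 phi2.
exists psi; split=> //.
- by move=> p x xp; rewrite (subvP (psig p)) // memv_img.
- by move=> x xe; rewrite -(phie x xe); apply: psiphi; rewrite -gef (subvP (addvSl e f)).
- by move=> x xf; rewrite -(phif x xf); apply: psiphi; rewrite -gef (subvP (addvSr e f)).
Qed.

End FreeQuotient.

Lemma free_pseudo_product_sym (K : fieldType) (M : finLieAlgType K)
    (gM : int -> {vspace M}) (e f : {vspace M}) m n mu :
  free_pseudo_product_fgla gM e f m n mu -> free_pseudo_product_fgla gM f e n m mu.
Proof.
move=> [pp k [de df] univ]; split=> //; first exact: pseudo_product_sym.
move=> M' g' e' f' pp' k' phi phig phi1 phi2.
by apply: univ phig phi2 phi1 => //; exact: pseudo_product_sym.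
Qed.

(** * Kind at least three *)

Section ProlongationTheory.
Variables (K : fieldType) (M : finLieAlgType K) (gM : int -> {vspace M}) (e f : {vspace M}).
Variables (G : lieAlgType K) (gG : int -> set G) (iota : {linear M -> G}).
Hypotheses (hG : is_prolongation gM gG iota) (hM : is_fgla gM).

Local Notation pp := (pp_prolongation gG iota e f).

Lemma gG_linear p a X Y : gG p X -> gG p Y -> gG p (a *: X + Y).
Proof.
have [d [b ->]] := gla_fin_dim (pro_gla hG) p => -[c _ <-] [c' _ <-].
exists (fun i => a * c i + c' i) => //.
rewrite scaler_sumr -big_split; apply: eq_bigr => i _.
by rewrite scalerDl scalerA.
Qed.

Lemma gG0 p : gG p 0.
Proof.
have [d [b ->]] := gla_fin_dim (pro_gla hG) p; exists (fun=> 0) => //.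
by rewrite big1 // => i _; rewrite scale0r.
Qed.

Lemma gGB p X Y : gG p X -> gG p Y -> gG p (X - Y).
Proof. by move=> Xp Yp; rewrite -scaleN1r addrC; exact: gG_linear. Qed.

Lemma gG_lie p q X Y : gG p X -> gG q Y -> gG (p + q) [lie X, Y].
Proof. exact: (gla_lie (pro_gla hG)). Qed.

Lemma gG_iota p u : u \in gM p -> gG p (iota u).
Proof.
case: hM => _ pos _ up; have [p0|/pos E] := ltP p 0.
  by rewrite (pro_neg hG p0); exists u.
by move: up; rewrite E memv0 => /eqP ->; rewrite linear0; exact: gG0.
Qed.

Lemma gG_negE p X : p < 0 -> gG p X -> exists2 u, u \in gM p & X = iota u.
Proof. by move=> p0; rewrite (pro_neg hG p0) => -[u up <-]; exists u. Qed.

(** Transitivity tested in degree -1 only: by the Leibniz rule the elements of [M] killed by [X]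
    form a subalgebra, and degree -1 generates. *)
Lemma gG_eq0 p X : 0 <= p -> gG p X ->
  (forall u, u \in gM (-1) -> [lie X, iota u] = 0) -> X = 0.
Proof.
move=> p0 Xp X0; have [U UP] := vspace_ker (lie X \o iota).
case: hM => _ _ [_ gen].
have Ulie : lie_subalgebra U.
  apply/lie_span_subP => x y /UP /= x0 /UP /= y0; apply/UP => /=.
  by rewrite (pro_hom hG) lie_leibniz x0 y0 lie0l linear0 addr0.
apply: (pro_transitive hG p0 Xp) => q Y q0 /(gG_negE q0)[u uq ->].
apply/UP; apply: (subvP (gen U Ulie _ q q0)) => //.
by apply/subvP => v /X0 v0; apply/UP.
Qed.

Lemma gM_lie p q u v : u \in gM p -> v \in gM q -> [lie u, v] \in gM (p + q).
Proof. by case: hM => hg _ _; exact: (gla_lie hg). Qed.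

Lemma pp_gG p X : pp p X -> gG p X.
Proof. by case. Qed.

Lemma pp_preserves X : pp 0 X -> preserves iota X e /\ preserves iota X f.
Proof.
move E : 0 => p Xp; case: Xp E => // {}p Y; first by move=> p0 _ E; rewrite -E in p0.
by move=> p0 _ _ E; rewrite -E in p0.
Qed.

Lemma pp_lie p X q Y : pp p X -> 0 < p -> q < 0 -> gG q Y -> pp (p + q) [lie X, Y].
Proof.
move=> Xp p1 q0 Yq; destruct Xp as [p X p0 _|X _ _ _|p X _ _ h].
- by have := lt_trans p0 p1; rewrite ltxx.
- by rewrite ltxx in p1.
- exact: h.
Qed.

End ProlongationTheory.

(** * Linear relations satisfied by an element of degree 1 *)

Section FilRelations.
Variables (K : fieldType) (M : finLieAlgType K) (gM : int -> {vspace M}) (e f : {vspace M}).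
Variables (m n mu : nat).
Variables (G : lieAlgType K) (gG : int -> set G) (iota : {linear M -> G}).
Hypotheses (hG : is_prolongation gM gG iota).
Hypothesis hM : free_pseudo_product_fgla gM e f m n mu.
Hypothesis mu3 : (2 < mu)%N.

(** With [w k = ad(a)^k b], both [w mu] and [[b, w (mu-1)]] lie below degree [-mu] and vanish. The
    Leibniz rule expands the bracket of [X] with each, and [psi] sends [w k] to [fil_v k]. The
    binomial coefficient is the sum of the numbers [k < mu] of letters [a] on which [[X, a]] can act
    inside [w k]. *)
Lemma filiform_relations X (a b a1 b1 a2 b2 : M) (xi eta : {linear M -> K^o}) :
    (forall x, x \in f -> xi x = 0) -> (forall x, x \in e -> eta x = 0) ->
    xi a = 1 -> eta b = 1 ->
    a \in e -> a1 \in e -> a2 \in e -> b \in f -> b1 \in f -> b2 \in f ->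
    [lie [lie X, iota a], iota a] = iota a1 -> [lie [lie X, iota a], iota b] = iota b1 ->
    [lie [lie X, iota b], iota a] = iota a2 -> [lie [lie X, iota b], iota b] = iota b2 ->
  'C(mu, 2)%:R * xi a1 + mu%:R * eta b1 = 0 /\ mu.-1%:R * xi a2 + eta b2 = 0.
Proof.
move=> xif etae xa eb ae a1e a2e bf b1f b2f Xaa Xab Xba Xbb.
case: (hM) => [[fg [_ _ gef _] ee ff] [_ [_ kind]] _ _].
have exa : exists2 a, a \in e & xi a != 0 by exists a; rewrite // xa oner_neq0.
have exb : exists2 b, b \in f & eta b != 0 by exists b; rewrite // eb oner_neq0.
have [psi [psihom _ psie psif]] := free_quotient_filiform hM xif etae exa exb.
have eg x : x \in e -> x \in gM (-1) by move=> xe; rewrite -gef (subvP (addvSl e f)).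
have fgg x : x \in f -> x \in gM (-1) by move=> xf; rewrite -gef (subvP (addvSr e f)).
pose w k := iter k (lie a) b.
have iotaw k : iota (w k.+1) = [lie iota a, iota (w k)] by rewrite -(pro_hom hG).
have wg k : w k \in gM (- k.+1%:Z).
  elim: k => [|k IH]; first exact: fgg.
  by rewrite (_ : - k.+2%:Z = -1 - k.+1%:Z); [exact: (gM_lie fg) (eg _ ae) IH|lia].
have psiw k : psi (w k) = fil_v K mu k.
  elim: k => [|k IH]; first by rewrite psif // eb scale1r.
  by rewrite /= psihom -/(w k) IH psie // xa scale1r fil_lie_av.
(* An element acting on [a] and [b] like a derivation of degree 0 acts on each of the [k] letters
   [a] of [w k] and on the final [b]. *)
have D0 D c d k : [lie D, iota a] = iota c -> [lie D, iota b] = iota d -> c \in e -> d \in f ->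
    exists2 u, [lie D, iota (w k)] = iota u & psi u = (k%:R * xi c + eta d) *: fil_v K mu k.
  move=> Dc Dd ce df; elim: k => [|k [u Du pu]].
    by exists d => //; rewrite psif // mul0r add0r.
  exists ([lie c, w k] + [lie a, u]).
    by rewrite iotaw lie_leibniz Dc Du linearD !(pro_hom hG).
  rewrite linearD /= !psihom psiw pu !psie // xa scale1r lieZl linearZ /= !fil_lie_av.
  by rewrite -scalerDl -natr1; congr (_ *: _); ring.
(* The bracket has the degree of [w k]. The exceptional term at [k = 0] comes from [[a, [X, b]] = -
   a2]; being sent to a multiple of [fil_a], it disappears under the next [ad(a)]. *)
have X1 k : exists2 u, [lie X, iota (w k.+1)] = iota u &
    psi u = ('C(k.+1, 2)%:R * xi a1 + k.+1%:R * eta b1) *: fil_v K mu k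
            - (if k == 0 then xi a2 *: fil_a K mu else 0).
  elim: k => [|k [u Xu pu]].
    exists (b1 - a2).
      by rewrite iotaw lie_leibniz Xab [X in _ + X]lieC Xba linearB.
    by rewrite linearB /= psif // psie // bin_small // mul0r add0r mul1r.
  have [u' Du pu'] := D0 _ a1 b1 k.+1 Xaa Xab a1e b1f.
  exists (u' + [lie a, u]); first by rewrite iotaw lie_leibniz Du Xu linearD (pro_hom hG).
  rewrite linearD /= psihom pu' pu psie // xa scale1r linearB linearZ /= fil_lie_av subr0.
  have -> : [lie fil_a K mu, (if k == 0 then xi a2 *: fil_a K mu else 0)] = 0.
    by case: ifP; rewrite ?linear0 // linearZ /= liexx scaler0.
  rewrite subr0 -scalerDl; congr (_ *: _).
  by rewrite [in RHS]binS bin1 natrD -[k.+2%:R]natr1; ring.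
have iota0 u : iota u = 0 -> u = 0 by move=> u0; apply: (pro_inj hG); rewrite u0 linear0.
have gM0 p u : p < - mu%:Z -> u \in gM p -> u = 0.
  by move=> /kind ->; rewrite memv0 => /eqP.
have vneq k c : (k < mu)%N -> c *: fil_v K mu k = 0 -> c = 0.
  move=> kmu /eqP; rewrite scaler_eq0 (negPf (fil_v_neq0 K kmu)) orbF => /eqP//.
split.
  have [u Xu pu] := X1 mu.-1; rewrite prednK in Xu pu; last by lia.
  rewrite (gM0 _ (w mu) _ (wg mu)) in Xu; last by lia.
  rewrite !linear0 in Xu; rewrite (iota0 u) // linear0 gtn_eqF in pu; last by lia.
  by apply: (@vneq mu.-1); [lia|rewrite pu subr0].
(* Here [2 < mu] matters: the index [mu.-2] is not 0, so the exceptional term is absent and the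
   bracket with [b] maps to a bracket of two commuting vectors. *)
have [u Xu pu] := X1 mu.-2; have E : mu.-2.+1 = mu.-1 by lia.
have [u' Du pu'] := D0 _ a2 b2 mu.-1 Xba Xbb a2e b2f.
have bw : [lie b, w mu.-1] = 0.
  by apply: gM0 (gM_lie fg (fgg _ bf) (wg mu.-1)); lia.
have : psi (u' + [lie b, u]) = 0.
  rewrite (iota0 (_ + _)) ?linear0 // linearD (pro_hom hG) -Du -Xu E -lie_leibniz.
  by rewrite -(pro_hom hG) bw !linear0.
rewrite linearD /= psihom pu pu' psif // eb scale1r gtn_eqF; last by lia.
by rewrite subr0 linearZ /= fil_lie_vv scaler0 addr0 => /vneq; apply; lia.
Qed.

End FilRelations.

(** * Vanishing of the degree 1 component *)

Section KindAtLeast3.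
Variables (K : numFieldType) (M : finLieAlgType K) (gM : int -> {vspace M}) (e f : {vspace M}).
Variables (m n mu : nat).
Variables (G : lieAlgType K) (gG : int -> set G) (iota : {linear M -> G}).
Hypotheses (hG : is_prolongation gM gG iota).
Hypothesis hM : free_pseudo_product_fgla gM e f m n mu.
Hypothesis mu3 : (2 < mu)%N.

Lemma functional_dual (V : vectType K) (U W : {vspace V}) x :
  (U :&: W)%VS = 0%VS -> x \in U -> x != 0 ->
  exists2 xi : {linear V -> K^o}, forall w, w \in W -> xi w = 0 & xi x = 1.
Proof.
move=> UW xU x0; apply: functional_separating; apply: contra x0 => xW.
by rewrite -memv0 -UW memv_cap xU.
Qed.

(** The assumption covers only functionals normalized at [x]. If [xi x = 1] and [zt y = 1], then
    [(1 - zt x) xi + zt] is normalized at [x], yet takes the value 1 at [y] because [xi y = 0]. *)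
Lemma functional_eq0 (V : vectType K) (U W : {vspace V}) x y :
  (U :&: W)%VS = 0%VS -> x \in U -> y \in U -> x != 0 ->
  (forall xi : {linear V -> K^o}, (forall w, w \in W -> xi w = 0) -> xi x = 1 -> xi y = 0) ->
  y = 0.
Proof.
move=> UW xU yU x0 h; apply/eqP; apply: contrapT => /negP y0.
have [xi xiW xix] := functional_dual UW xU x0.
have [zt ztW zty] := functional_dual UW yU y0.
pose c : K := (1 - zt x : K).
pose th0 v : K^o := (c *: xi v + zt v).
have thl : linear th0.
  move=> k u v; rewrite /th0 (linearP xi) (linearP zt) scalerDr [in RHS]scalerDr !scalerA [c * k]mulrC.
  by rewrite addrACA.
pose th : {linear V -> K^o} := HB.pack th0 (GRing.isLinear.Build _ _ _ _ th0 thl).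
have := h th; rewrite /= /th0 xix zty (h xi) // scaler0 add0r => E.
suff /eqP : (1 : K^o) = 0 by rewrite oner_eq0.
apply: E => [w wW|]; first by rewrite xiW // ztW // scaler0 addr0.
by rewrite [c *: 1]mulr1 /c subrK.
Qed.

Lemma pp1_preserves X x : pp_prolongation gG iota e f 1 X -> x \in gM (-1) ->
  preserves iota [lie X, iota x] e /\ preserves iota [lie X, iota x] f.
Proof.
move=> X1 xg; case: (hM) => [[fg _ _ _] _ _ _].
have N1 : -1 < 0 :> int by [].
have := pp_lie X1 ltr01 N1 (gG_iota hG fg xg); rewrite subrr.
exact: pp_preserves.
Qed.

(** Substituting [s = -(mu-1) t] in twice the first equation leaves [mu (2 - (mu-1)^2) t = 0], since
    [2 'C(mu, 2) = mu (mu-1)]. *)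
Lemma bin_system (s t : K) :
  'C(mu, 2)%:R * s + mu%:R * t = 0 -> mu.-1%:R * t + s = 0 -> s = 0 /\ t = 0.
Proof.
move=> E1 /eqP; rewrite addr_eq0 eq_sym eqr_oppLR => /eqP sE.
have binE : 2 * 'C(mu, 2)%:R = mu%:R * mu.-1%:R :> K.
  by have := mul_bin_diag mu 1; rewrite bin1 -!natrM => ->.
have E2 : 2 * ('C(mu, 2)%:R * s + mu%:R * t) = 0 by rewrite E1 mulr0.
rewrite mulrDr mulrA binE sE in E2.
have : mu%:R * (2 - mu.-1%:R ^+ 2) * t = 0 by rewrite -[RHS]E2; ring.
move/eqP; rewrite !mulf_eq0 pnatr_eq0 subr_eq0 -natrX eqr_nat.
rewrite (_ : (mu == 0)%N = false); last by lia.
rewrite (_ : (2 == mu.-1 ^ 2)%N = false) /=; last by apply/negP => /eqP; nia.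
by move/eqP => t0; rewrite sE t0 mulr0 oppr0.
Qed.

Lemma kind_ge3_pp1 X : pp_prolongation gG iota e f 1 X -> X = 0.
Proof.
move=> X1; case: (hM) => [[fg [e0 f0 gef ef0] ee ff] _ _ _].
have fe0 : (f :&: e)%VS = 0%VS by rewrite capvC.
have eg x : x \in e -> x \in gM (-1) by move=> xe; rewrite -gef (subvP (addvSl e f)).
have fgg x : x \in f -> x \in gM (-1) by move=> xf; rewrite -gef (subvP (addvSr e f)).
have key a b : a \in e -> b \in f -> a != 0 -> b != 0 ->
    [/\ [lie [lie X, iota a], iota a] = 0, [lie [lie X, iota a], iota b] = 0,
        [lie [lie X, iota b], iota a] = 0 & [lie [lie X, iota b], iota b] = 0].
  move=> ae bf a0 b0.
  have [pe pf] := pp1_preserves X1 (eg _ ae); have [qe qf] := pp1_preserves X1 (fgg _ bf).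
  have [a1 a1e Xaa] := pe a ae; have [b1 b1f Xab] := pf b bf.
  have [a2 a2e Xba] := qe a ae; have [b2 b2f Xbb] := qf b bf.
  have rel (xi eta : {linear M -> K^o}) :
      (forall w, w \in f -> xi w = 0) -> xi a = 1 ->
      (forall w, w \in e -> eta w = 0) -> eta b = 1 ->
      [/\ xi a1 = 0, eta b1 = 0, xi a2 = 0 & eta b2 = 0].
    move=> xif xa etae eb.
    have [r1 r2] := filiform_relations hG hM mu3 xif etae xa eb ae a1e a2e bf b1f b2f Xaa Xab Xba Xbb.
    (* After the exchange of [e] and [f], the vectors [b2], [a2], [b1], [a1] stand for [a1], [b1],
       [a2], [b2]. Hence [r4] involves the same unknowns as [r1], and [r2] the same as [r3]. *)
    have [r3 r4] := filiform_relations hG (free_pseudo_product_sym hM) mu3 etae xif eb xa bf b2f b1f ae a2e a1e Xbb Xba Xab Xaa.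
    have [-> ->] := bin_system r1 r4.
    by have [-> ->] := bin_system r3 r2.
  have [xi0 xi0f xi0a] := functional_dual ef0 ae a0.
  have [eta0 eta0e eta0b] := functional_dual fe0 bf b0.
  have a10 : a1 = 0 by apply: (functional_eq0 ef0 ae) => // xi xif xia; have [] := rel xi eta0.
  have a20 : a2 = 0 by apply: (functional_eq0 ef0 ae) => // xi xif xia; have [] := rel xi eta0.
  have b10 : b1 = 0 by apply: (functional_eq0 fe0 bf) => // eta etae etab; have [] := rel xi0 eta.
  have b20 : b2 = 0 by apply: (functional_eq0 fe0 bf) => // eta etae etab; have [] := rel xi0 eta.
  by rewrite Xaa Xab Xba Xbb a10 a20 b10 b20 !linear0.
have exnz (V : {vspace M}) : V <> 0%VS -> exists2 v, v \in V & v != 0.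
  by move=> V0; exists (vpick V); rewrite ?memv_pick // vpick0; apply/eqP.
have [a0 a0e a0n] := exnz _ e0; have [b0 b0f b0n] := exnz _ f0.
have nz0 x y : [lie [lie X, iota x], iota y] = 0 \/ x = 0 \/ y = 0 ->
    [lie [lie X, iota x], iota y] = 0.
  by case=> // -[->|->]; rewrite !linear0 ?lie0l.
have Xef a b : a \in e -> b \in f -> [lie [lie X, iota a], iota b] = 0.
  move=> ae bf; apply: nz0; have [->|an] := eqVneq a 0; first by right; left.
  have [->|bn] := eqVneq b 0; first by right; right.
  by left; have [] := key a b.
have Xfe a b : a \in e -> b \in f -> [lie [lie X, iota b], iota a] = 0.
  move=> ae bf; apply: nz0; have [->|an] := eqVneq a 0; first by right; right.
  have [->|bn] := eqVneq b 0; first by right; left.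
  by left; have [] := key a b.
(* On an abelian [V] the form [[[X, x], y]] is symmetric, so it vanishes as soon as its diagonal
   does. *)
have pol (V : {vspace M}) : lie_span V V = 0%VS ->
    (forall x, x \in V -> [lie [lie X, iota x], iota x] = 0) ->
    forall x y, x \in V -> y \in V -> [lie [lie X, iota x], iota y] = 0.
  move=> /lie_span0P VV V0 x y xV yV.
  have sym : [lie [lie X, iota x], iota y] = [lie [lie X, iota y], iota x].
    have := lie_leibniz X (iota x) (iota y).
    rewrite -(pro_hom hG) VV // !linear0 [X in _ + X]lieC => /esym/eqP.
    by rewrite subr_eq0 => /eqP.
  have := V0 (x + y) (memvD xV yV).
  rewrite !linearD /= !lieDl !V0 // add0r addr0 -sym => /eqP.
  by rewrite -mulr2n -scaler_nat scaler_eq0 pnatr_eq0 => /eqP.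
have Xee : forall x y, x \in e -> y \in e -> [lie [lie X, iota x], iota y] = 0.
  apply: pol => // x xe; apply: nz0; have [->|xn] := eqVneq x 0; first by right; left.
  by left; have [] := key x b0.
have Xff : forall x y, x \in f -> y \in f -> [lie [lie X, iota x], iota y] = 0.
  apply: pol => // x xe; apply: nz0; have [->|xn] := eqVneq x 0; first by right; left.
  by left; have [] := key a0 x.
(* Transitivity is used twice, for [X] in degree 1 and then for [[X, u]] in degree 0. *)
apply: (gG_eq0 hG fg _ (pp_gG X1)) => // u ug.
have X0 := gG_lie hG (pp_gG X1) (gG_iota hG fg ug); rewrite subrr in X0.
apply: (gG_eq0 hG fg _ X0) => // v.
move: ug; rewrite -gef => /memv_addP[ue ueE [uf ufF ->]] /memv_addP[ve veE [vf vfF ->]].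
by rewrite !linearD /= !lieDl (Xee ue ve) // (Xef ue vf) // (Xfe ve uf) // (Xff uf vf) // !addr0.
Qed.

End KindAtLeast3.

(** * Derivations of the negative part of sl_(m+n+1) *)

Section InnerDerivations.
Variables (K : numFieldType) (m n : nat).
Local Notation N := (m + n).+1.
Local Notation gr := (sl_gr K (@bdeg m n)).
Local Notation mid := (mid m n).
Local Notation E := (elem_sl K).
Implicit Types (r c i j k : 'I_N).

(** [P j] and [Q k] are the values of a derivation of degree [p] on [E mid j] and [E k mid], hence
    on the generators of the negative part. Its value on [E k j] is then [[Q k, E mid j] +
    [E k mid, P j]], and [derE], [derF] say that it respects the vanishing brackets of [E k j] with
    the generators. [P_mid] and [Q_mid] hold for degree reasons when [p > 0]; for [p = 0] they say
    that [e] and [f] are preserved. *)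
Variables (P Q : 'I_N -> sl K N) (p : int).
Hypothesis (m0 : (0 < m)%N) (n0 : (0 < n)%N) (p0 : 0 <= p).
Hypothesis Pp : forall j, (j < m)%N -> P j \in gr (p - 1).
Hypothesis Qp : forall k, (m < k)%N -> Q k \in gr (p - 1).
Hypothesis P_mid : forall j k, (j < m)%N -> (m < k)%N -> vsval (P j) k mid = 0.
Hypothesis Q_mid : forall j k, (j < m)%N -> (m < k)%N -> vsval (Q k) mid j = 0.
Hypothesis derE : forall j j' k, (j < m)%N -> (j' < m)%N -> (m < k)%N ->
  [lie [lie Q k, E mid j] + [lie E k mid, P j], E mid j'] + [lie E k j, P j'] = 0.
Hypothesis derF : forall j k k', (j < m)%N -> (m < k)%N -> (m < k')%N ->
  [lie [lie Q k, E mid j] + [lie E k mid, P j], E k' mid] + [lie E k j, Q k'] = 0.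

Lemma ltm_mid j : (j < m)%N -> (j == mid) = false.
Proof. by move=> jm; rewrite -val_eqE /= ltn_eqF. Qed.

Lemma gtm_mid k : (m < k)%N -> (k == mid) = false.
Proof. by move=> mk; rewrite -val_eqE /= gtn_eqF. Qed.

Lemma ltm_gtm j k : (j < m)%N -> (m < k)%N -> (j == k) = false.
Proof. by move=> jm mk; rewrite -val_eqE /= ltn_eqF // (ltn_trans jm). Qed.

Lemma derE_entry j j' k r c : (j < m)%N -> (j' < m)%N -> (m < k)%N ->
  (- (r == mid)%:R * vsval (Q k) j mid + (r == k)%:R * vsval (P j) mid mid
     - vsval (P j) r k) * (c == j')%:R
  - (r == mid)%:R * (vsval (Q k) j' mid * (c == j)%:R - vsval (P j) j' k * (c == mid)%:R)
  + ((r == k)%:R * vsval (P j') j c - vsval (P j') r k * (c == j)%:R) = 0.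
Proof.
move=> jm jm' mk; have := congr1 (fun x : sl K N => vsval x r c) (derE jm jm' mk).
have nmj i : (i < m)%N -> mid != i by move=> im; rewrite eq_sym ltm_mid.
have nkm : k != mid by rewrite gtm_mid.
have nkj : k != j by rewrite eq_sym ltm_gtm.
rewrite [[lie E k mid, P j]]lieC [[lie E k j, P j']]lieC !(sl_entryD, sl_entryN, sl_entry0).
rewrite !val_lie_elem ?nmj // !(sl_entryD, sl_entryN) !val_lie_elem ?nmj //.
rewrite [mid == j]eq_sym (ltm_mid jm) (ltm_mid jm') (ltm_gtm jm' mk) !eqxx /= => <-.
by ring.
Qed.

Lemma derF_entry j k k' r c : (j < m)%N -> (m < k)%N -> (m < k')%N ->
  (- (r == mid)%:R * vsval (Q k) j k' + (r == k)%:R * vsval (P j) mid k') * (c == mid)%:R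
  - (r == k')%:R * (vsval (Q k) mid mid * (c == j)%:R - vsval (Q k) j c
       - vsval (P j) mid k * (c == mid)%:R)
  + ((r == k)%:R * vsval (Q k') j c - vsval (Q k') r k * (c == j)%:R) = 0.
Proof.
move=> jm mk mk'; have := congr1 (fun x : sl K N => vsval x r c) (derF jm mk mk').
have nmj : mid != j by rewrite eq_sym ltm_mid.
have nkm i : (m < i)%N -> i != mid by move=> mi; rewrite gtm_mid.
have nkj : k != j by rewrite eq_sym ltm_gtm.
rewrite [[lie E k mid, P j]]lieC [[lie E k j, Q k']]lieC !(sl_entryD, sl_entryN, sl_entry0).
rewrite !val_lie_elem ?nkm // !(sl_entryD, sl_entryN) !val_lie_elem ?nkm //.
rewrite (gtm_mid mk') [k' == j]eq_sym (ltm_gtm jm mk') [mid == k]eq_sym (gtm_mid mk) !eqxx /= => <-.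
by ring.
Qed.

Let k0 : 'I_N := ord_max.
Let mk0 : (m < k0)%N. Proof. by rewrite /= -{1}[m]addn0 ltn_add2l. Qed.
Let j0 : 'I_N := ord0.
Let j0m : (j0 < m)%N. Proof. by []. Qed.

Lemma eq0_double (x : K) : x + x = 0 -> x = 0.
Proof. by move/eqP; rewrite -mulr2n mulrn_eq0 => /eqP. Qed.

Lemma double_inj (x y c : K) : x + x - c = y + y - c -> x = y.
Proof.
move/addIr/eqP; rewrite -subr_eq0 opprD addrACA => /eqP/eq0_double/eqP.
by rewrite subr_eq0 => /eqP.
Qed.

(** The corrections at [i] and [mid] cancel in the trace, which is therefore [N] times [d]. *)
Lemma trace_split (x : sl K N) (d : K) (u : K) i : i != mid ->
  (forall r, vsval x r r = d + (r == i)%:R * u - (r == mid)%:R * u) -> d = 0.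
Proof.
move=> im h; have := sl_trace x; rewrite /mxtrace (eq_bigr _ (fun r _ => h r)).
rewrite sumrB big_split /= sumr_const card_ord.
have one (s : 'I_N) : \sum_r (r == s)%:R * u = u.
  rewrite (bigD1 s) //= eqxx mul1r big1 ?addr0 // => r /negPf ->.
  by rewrite mul0r.
by rewrite !one addrK => /eqP; rewrite mulrn_eq0 => /eqP.
Qed.

Lemma P_off j k r : (j < m)%N -> (m < k)%N -> r != mid -> r != k -> vsval (P j) r k = 0.
Proof.
move=> jm mk /negPf rm /negPf rk; have := derE_entry r j jm jm mk.
rewrite rm rk eqxx /= => h; apply: eq0_double; apply: oppr_inj; rewrite oppr0 -[RHS]h; ring.
Qed.

(** Once [P_diag0] removes the entries at [k], this is the form imposed by an inner derivation: row
    [j] of [[Z, E mid j']] is [Z j mid] at column [j'], with [Z j mid = - P j mid mid]. *)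
Lemma P_row j j' k c : (j < m)%N -> (j' < m)%N -> (m < k)%N ->
  vsval (P j') j c = vsval (P j') k k * (c == j)%:R
    - (vsval (P j) mid mid - vsval (P j) k k) * (c == j')%:R.
Proof.
move=> jm jm' mk; have := derE_entry k c jm jm' mk.
rewrite (gtm_mid mk) eqxx /= => h; apply/eqP; rewrite -subr_eq0; apply/eqP; rewrite -[RHS]h; ring.
Qed.

(* derE leaves P j free up to a scalar matrix, which the trace excludes. *)
Lemma P_diag0 j k : (j < m)%N -> (m < k)%N -> vsval (P j) k k = 0.
Proof.
move=> jm mk.
have dE i : (m < i)%N -> vsval (P j) i i = vsval (P j) k k.
  move=> mi; apply: (@double_inj _ _ (vsval (P j) mid mid)).
  transitivity (vsval (P j) j j); first by rewrite (P_row j jm jm mi) eqxx /=; ring.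
  by rewrite (P_row j jm jm mk) eqxx /=; ring.
apply: (@trace_split (P j) _ (vsval (P j) k k - vsval (P j) mid mid) j); first by rewrite ltm_mid.
move=> r; case: (ltngtP r m) => [rm|mr|rE].
- rewrite (P_row r rm jm mk) eqxx (ltm_mid rm).
  by have [->|rj] := eqVneq r j; rewrite /=; ring.
- by rewrite dE // [r == j]eq_sym (ltm_gtm jm mr) (gtm_mid mr) /=; ring.
- have -> : r = mid by exact: val_inj.
  by rewrite eqxx [mid == j]eq_sym (ltm_mid jm) /=; ring.
Qed.

(** For the inner derivation of [Z] both sides are [- Z j k]: the values on [e] and on [f] prescribe
    the same corner block of [Z]. *)
Lemma PQ_corner j k : (j < m)%N -> (m < k)%N -> vsval (P j) mid k = - vsval (Q k) j mid.
Proof.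
move=> jm mk; have := derE_entry mid j jm jm mk.
rewrite [mid == k]eq_sym (gtm_mid mk) (ltm_mid jm) !eqxx /= => h.
apply/eqP; rewrite -subr_eq0; apply/eqP; apply: eq0_double; apply: oppr_inj.
rewrite oppr0 -[RHS]h; ring.
Qed.

(** This and the next two lemmas are the counterparts for [Q] and [derF], with rows and columns
    exchanged. *)
Lemma Q_off j k c : (j < m)%N -> (m < k)%N -> c != mid -> c != j -> vsval (Q k) j c = 0.
Proof.
move=> jm mk /negPf cm /negPf cj; have := derF_entry k c jm mk mk.
rewrite cm cj (gtm_mid mk) eqxx /= => h; apply: eq0_double; rewrite -[RHS]h; ring.
Qed.

Lemma Q_col j k k' r : (j < m)%N -> (m < k)%N -> (m < k')%N ->
  vsval (Q k') r k = (r == k)%:R * vsval (Q k') j j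
    - (r == k')%:R * (vsval (Q k) mid mid - vsval (Q k) j j).
Proof.
move=> jm mk mk'; have := derF_entry r j jm mk mk'.
rewrite (ltm_mid jm) eqxx /= => h; apply/eqP; rewrite eq_sym -subr_eq0; apply/eqP.
rewrite -[RHS]h; ring.
Qed.

Lemma Q_diag0 j k : (j < m)%N -> (m < k)%N -> vsval (Q k) j j = 0.
Proof.
move=> jm mk.
have dE i : (i < m)%N -> vsval (Q k) i i = vsval (Q k) j j.
  move=> im; apply: (@double_inj _ _ (vsval (Q k) mid mid)).
  transitivity (vsval (Q k) k k); first by rewrite (Q_col k im mk mk) eqxx /=; ring.
  by rewrite (Q_col k jm mk mk) eqxx /=; ring.
apply: (@trace_split (Q k) _ (vsval (Q k) j j - vsval (Q k) mid mid) k); first by rewrite gtm_mid.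
move=> r; case: (ltngtP r m) => [rm|mr|rE].
- by rewrite dE // (ltm_gtm rm mk) (ltm_mid rm) /=; ring.
- rewrite (Q_col r jm mr mk) eqxx (gtm_mid mr).
  by have [->|rj] := eqVneq r k; rewrite /=; ring.
- have -> : r = mid by exact: val_inj.
  by rewrite eqxx [mid == k]eq_sym (gtm_mid mk) /=; ring.
Qed.

Lemma derivation_inner : exists2 Z, Z \in gr p &
  (forall j, (j < m)%N -> [lie Z, E mid j] = P j) /\
  (forall k, (m < k)%N -> [lie Z, E k mid] = Q k).
Proof.
have bmid : bdeg mid = 1 by rewrite /bdeg /= ltnn leqnn.
have blt i : (i < m)%N -> bdeg i = 2 by move=> im; rewrite /bdeg im ltnW.
have bgt i : (m < i)%N -> bdeg i = 0 by move=> mi; rewrite /bdeg; lia.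
(* The rows of the first block are read off from row [mid] of [[Z, E mid r]], the columns of the
   last block from column [mid] of [[Z, E c mid]]. The other entries have negative degree, except
   [(mid, mid)], which is normalized to 0. Subtracting a scalar matrix then restores the zero trace
   without changing any bracket. *)
pose Z0 := \matrix_(r, c) (if (r < m)%N then - vsval (P r) mid c
  else if (m < c)%N then vsval (Q c) r mid else 0) : 'M[K]_N.
pose s := \tr Z0 / N%:R.
have trZ : \tr (Z0 - s%:M) = 0.
  by rewrite linearB /= mxtrace_scalar -[X in _ - X]mulr_natr divfK ?pnatr_eq0 // subrr.
have Z0_deg r c : bdeg r - bdeg c != p -> Z0 r c = 0.
  move=> rc; rewrite mxE; case: ifPn => rm.
    have /mem_sl_supp -> := Pp rm; rewrite ?oppr0 //.
    by move: rc; rewrite blt // bmid; lia.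
  case: ifPn => // cm; have /mem_sl_supp -> // := Qp cm.
  by move: rc; rewrite (bgt c) // bmid; lia.
have s0 : p != 0 -> s = 0.
  by move=> pn0; rewrite /s /mxtrace big1 ?mul0r // => i _; rewrite Z0_deg // subrr eq_sym.
have ZE r c : vsval (to_sl (Z0 - s%:M)) r c = Z0 r c - s * (r == c)%:R.
  rewrite to_slK // [LHS]mxE [X in _ + X]mxE [X in - X]mxE; congr (_ - _).
  by case: (r == c); rewrite ?mulr1 ?mulr0.
exists (to_sl (Z0 - s%:M)).
  apply/mem_sl_supp => r c rc; rewrite ZE Z0_deg // sub0r.
  have [E1|/s0 ->] := eqVneq p 0; last by rewrite mul0r oppr0.
  have [rc'|_] := eqVneq r c; last by rewrite mulr0 oppr0.
  by rewrite rc' subrr E1 eqxx in rc.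
have deg_m2 i j x : (m < i)%N -> (j < m)%N -> x \in gr (p - 1) -> vsval x i j = 0.
  move=> mi jm /mem_sl_supp ->//; by rewrite bgt // blt //; lia.
split=> [j jm|k mk]; apply: sl_ext => r c.
  rewrite val_lie_elem; last by rewrite eq_sym ltm_mid.
  rewrite !ZE [j == c]eq_sym.
  have -> : (Z0 r mid - s * (r == mid)%:R) * (c == j)%:R - (r == mid)%:R * (Z0 j c - s * (c == j)%:R)
    = Z0 r mid * (c == j)%:R - (r == mid)%:R * Z0 j c by ring.
  rewrite !mxE jm ltnn; case: (ltngtP r m) => [rm|mr|rE].
  - by rewrite (ltm_mid rm) (P_row c rm jm mk0) (P_diag0 jm mk0) (P_diag0 rm mk0) /=; ring.
  - rewrite (gtm_mid mr) !mul0r subrr; case: (ltngtP c m) => [cm|mc|cE].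
    + by rewrite deg_m2 // Pp.
    + have [<-|rc] := eqVneq r c; first by rewrite P_diag0.
      by rewrite P_off // gtm_mid.
    + by have -> : c = mid by [exact: val_inj]; rewrite P_mid.
  - have -> : r = mid by exact: val_inj.
    by rewrite eqxx mul0r /=; ring.
rewrite val_lie_elem; last by rewrite gtm_mid.
rewrite !ZE [mid == c]eq_sym.
have -> : (Z0 r k - s * (r == k)%:R) * (c == mid)%:R - (r == k)%:R * (Z0 mid c - s * (c == mid)%:R)
    = Z0 r k * (c == mid)%:R - (r == k)%:R * Z0 mid c by ring.
have -> : Z0 r k = vsval (Q k) r mid.
  by rewrite mxE mk; case: ifPn => // rm; rewrite PQ_corner // opprK.
rewrite mxE ltnn; case: (ltngtP c m) => [cm|mc|cE].
- rewrite (ltm_mid cm) !mulr0 subrr; case: (ltngtP r m) => [rm|mr|rE].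
  + have [<-|rc] := eqVneq r c; first by rewrite Q_diag0.
    by rewrite Q_off ?ltm_mid // eq_sym.
  + by rewrite deg_m2 // Qp.
  + by have -> : r = mid by [exact: val_inj]; rewrite Q_mid.
- by rewrite (gtm_mid mc) (Q_col r j0m mc mk) (Q_diag0 j0m mk) (Q_diag0 j0m mc) /=; ring.
- have -> : c = mid by exact: val_inj.
  by rewrite eqxx /=; ring.
Qed.

End InnerDerivations.

(** * Kind two *)

Section DualBasis.
Variables (K : fieldType) (V : vectType K) (U W : {vspace V}).

Lemma dual_basis_functional i : (U :&: W)%VS = 0%VS -> (i < \dim U)%N ->
  exists2 xi : {linear V -> K^o}, forall w, w \in W -> xi w = 0 &
    forall j, (j < \dim U)%N -> xi (vbasis U)`_j = (j == i)%:R.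
Proof.
move=> UW iU; exists (coord (vbasis U) (Ordinal iU) \o daddv_pi U W) => [w wW|j jU] /=.
  have := daddv_pi_add UW (subvP (addvSr U W) _ wW).
  rewrite [daddv_pi W U w]daddv_pi_id 1?capvC // => /eqP.
  by rewrite -subr_eq0 addrK => /eqP ->; rewrite linear0.
have bU : (vbasis U)`_j \in U by rewrite vbasis_mem // mem_nth ?size_tuple.
rewrite daddv_pi_id //.
by rewrite (coord_free (Ordinal jU) (Ordinal iU) (basis_free (vbasisP U))).
Qed.

End DualBasis.

(** * Identification of [M] with the negative part of [sl_(m+n+1)] *)

Section Kind2.
Variables (K : numFieldType) (M : finLieAlgType K) (gM : int -> {vspace M}) (e f : {vspace M}).
Variables (m n : nat).
Hypothesis hM : free_pseudo_product_fgla gM e f m n 2.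
Local Notation N := (m + n).+1.
Local Notation deg := (@bdeg m n).
Local Notation gr := (sl_gr K deg).
Local Notation mid := (mid m n).
Local Notation E := (elem_sl K).
Implicit Types (A B : sl K N) (r c j k : 'I_N).

Let fg : is_fgla gM. Proof. by case: hM => [[]]. Qed.
Let gef : (e + f)%VS = gM (-1). Proof. by case: hM => [[_ []]]. Qed.
Let ef0 : (e :&: f)%VS = 0%VS. Proof. by case: hM => [[_ []]]. Qed.
Let ee : lie_span e e = 0%VS. Proof. by case: hM => [[]]. Qed.
Let ff : lie_span f f = 0%VS. Proof. by case: hM => [[]]. Qed.
Let dim_e : \dim e = m. Proof. by case: hM => _ _ []. Qed.
Let dim_f : \dim f = n. Proof. by case: hM => _ _ []. Qed.

Lemma kind2_m0 : (0 < m)%N.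
Proof.
case: (hM) => [[_ [e0 _ _ _] _ _] _ _ _]; rewrite -dim_e lt0n dimv_eq0.
by apply/eqP.
Qed.

Lemma kind2_n0 : (0 < n)%N.
Proof.
case: (hM) => [[_ [_ f0 _ _] _ _] _ _ _]; rewrite -dim_f lt0n dimv_eq0.
by apply/eqP.
Qed.

(** Both bases are numbered by positions in the matrix: columns [j < m] for [e], rows [k > m] for
    [f], whence the shift by [m.+1] in [fbas]. *)
Definition ebas (j : nat) : M := (vbasis e)`_j.
Definition fbas (k : nat) : M := (vbasis f)`_(k - m.+1).

Lemma ebas_e j : (j < m)%N -> ebas j \in e.
Proof. by move=> jm; rewrite vbasis_mem // mem_nth // size_tuple dim_e. Qed.

Lemma fbas_ltn k : (m < k)%N -> (k - m.+1 < n)%N.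
Proof. by move=> mk; rewrite ltn_subLR // addSn ltn_ord. Qed.

Lemma fbas_f k : (m < k)%N -> fbas k \in f.
Proof. by move=> mk; rewrite vbasis_mem // mem_nth // size_tuple dim_f fbas_ltn. Qed.

Let eg x : x \in e -> x \in gM (-1).
Proof. by move=> xe; rewrite -gef (subvP (addvSl e f)). Qed.
Let fgg x : x \in f -> x \in gM (-1).
Proof. by move=> xf; rewrite -gef (subvP (addvSr e f)). Qed.

Definition th_e A : M := \sum_(j : 'I_N | (j < m)%N) vsval A mid j *: ebas j.
Definition th_f A : M := \sum_(k : 'I_N | (m < k)%N) vsval A k mid *: fbas k.
Definition th_2 A : M := \sum_(k : 'I_N | (m < k)%N) \sum_(j : 'I_N | (j < m)%N)
  vsval A k j *: [lie fbas k, ebas j].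
(** It is defined on all of [sl] but reads only the entries of negative degree; its restriction to
    the negative part will be the isomorphism with [M]. *)
Definition theta A : M := th_e A + th_f A + th_2 A.

Fact theta_linear : linear theta.
Proof.
move=> a A B; rewrite /theta !scalerDr.
have -> : th_e (a *: A + B) = a *: th_e A + th_e B.
  rewrite /th_e scaler_sumr -big_split; apply: eq_bigr => j _.
  by rewrite sl_entryD sl_entryZ scalerDl scalerA.
have -> : th_f (a *: A + B) = a *: th_f A + th_f B.
  rewrite /th_f scaler_sumr -big_split; apply: eq_bigr => j _.
  by rewrite sl_entryD sl_entryZ scalerDl scalerA.
have -> : th_2 (a *: A + B) = a *: th_2 A + th_2 B.
  rewrite /th_2 scaler_sumr -big_split; apply: eq_bigr => k _.
  rewrite scaler_sumr -big_split; apply: eq_bigr => j _.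
  by rewrite sl_entryD sl_entryZ scalerDl scalerA.
by rewrite (addrACA (a *: th_e A)) (addrACA (a *: th_e A + _)).
Qed.
HB.instance Definition _ :=
  GRing.isLinear.Build K (sl K N) M *:%R theta theta_linear.

Lemma th_e_e A : th_e A \in e.
Proof. by apply: memv_suml => j jm; rewrite memvZ // ebas_e. Qed.

Lemma th_f_f A : th_f A \in f.
Proof. by apply: memv_suml => k mk; rewrite memvZ // fbas_f. Qed.

Lemma th_2_gr A : th_2 A \in gM (-2).
Proof.
apply: memv_suml => k mk; apply: memv_suml => j jm; rewrite memvZ //.
by have := gM_lie fg (fgg (fbas_f mk)) (eg (ebas_e jm)).
Qed.

(** The filtration by degree: [low 0] is the negative part and [low 3] is everything. *)
Definition low (k : int) : {vspace sl K N} := sl_supp K (fun r c => deg r - deg c < k).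
Local Notation neg := (low 0).

Lemma bdegE r : deg r = if (r < m)%N then 2 else if (m < r)%N then 0 else 1.
Proof. by rewrite /bdeg; case: (ltngtP r m). Qed.

Lemma theta_gr p A : A \in gr p -> theta A \in gM p.
Proof.
move=> /mem_sl_supp Ap; rewrite /theta !memvD //; apply: memv_suml.
- move=> j jm; have [<-|/Ap ->] := eqVneq (deg mid - deg j) p; last by rewrite scale0r mem0v.
  by rewrite memvZ // !bdegE jm /= ltnn eg // ebas_e.
- move=> k mk; have [<-|/Ap ->] := eqVneq (deg k - deg mid) p; last by rewrite scale0r mem0v.
  by rewrite memvZ // !bdegE mk /= ltnn ltnNge ltnW //= fgg // fbas_f.
- move=> k mk; apply: memv_suml => j jm.
  have [<-|/Ap ->] := eqVneq (deg k - deg j) p; last by rewrite scale0r mem0v.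
  rewrite memvZ // !bdegE mk jm ltnNge ltnW //=.
  by have := gM_lie fg (fgg (fbas_f mk)) (eg (ebas_e jm)).
Qed.

Lemma gM_m2_central u v : u \in gM (-2) -> (exists2 p, p < 0 & v \in gM p) -> [lie u, v] = 0.
Proof.
move=> u2 [p p0 vp]; case: (hM) => [_ [_ [_ kind]] _ _].
by have := gM_lie fg u2 vp; rewrite kind ?memv0 => [/eqP|] //; lia.
Qed.

(** For negative [A] and [B] only the corner block of the bracket survives, through the intermediate
    index [mid]. In [M] only brackets of [f] with [e] survive, since [e] and [f] are abelian and
    degree -2 is central. *)
Lemma theta_lie A B : A \in neg -> B \in neg -> theta [lie A, B] = [lie theta A, theta B].
Proof.
move=> /mem_sl_supp An /mem_sl_supp Bn.
have An0 r c : deg c <= deg r -> vsval A r c = 0 by move=> rc; apply: An; lia.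
have Bn0 r c : deg c <= deg r -> vsval B r c = 0 by move=> rc; apply: Bn; lia.
have dmid : deg mid = 1 by rewrite bdegE /= ltnn.
have ABe : th_e [lie A, B] = 0.
  rewrite /th_e big1 // => j jm; rewrite val_lieE big1 ?scale0r // => k _.
  have [km|km] := leP (deg k) (deg mid); first by rewrite (An0 mid) // (Bn0 mid) // !mul0r subrr.
  by rewrite (An0 k j) ?(Bn0 k j) ?mulr0 ?subrr //; move: km jm; rewrite dmid /bdeg; lia.
have ABf : th_f [lie A, B] = 0.
  rewrite /th_f big1 // => k mk; rewrite val_lieE big1 ?scale0r // => j _.
  have [mj|mj] := leP (deg mid) (deg j); first by rewrite (An0 j mid) // (Bn0 j mid) // !mulr0 subrr.
  by rewrite (An0 k j) ?(Bn0 k j) ?mul0r ?subrr //; move: mj mk; rewrite dmid /bdeg; lia.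
rewrite {1}/theta ABe ABf !add0r.
have c2 C u : u \in gM (-1) -> [lie th_2 C, u] = 0.
  by move=> u1; apply: gM_m2_central; [exact: th_2_gr|exists (-1)].
have c22 C C' : [lie th_2 C, th_2 C'] = 0.
  by apply: gM_m2_central; [exact: th_2_gr|exists (-2); rewrite ?th_2_gr].
have /lie_span0P ee' := ee; have /lie_span0P ff' := ff.
have c2e C D : [lie th_2 C, th_e D] = 0 by rewrite c2 // eg // th_e_e.
have c2f C D : [lie th_2 C, th_f D] = 0 by rewrite c2 // fgg // th_f_f.
have eeq C D : [lie th_e C, th_e D] = 0 by rewrite ee' // th_e_e.
have ffq C D : [lie th_f C, th_f D] = 0 by rewrite ff' // th_f_f.
rewrite /theta !linearD /= !lieDl !(c2e, c2f, c22, eeq, ffq).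
rewrite [[lie _, th_2 B]]lieC c2e [[lie th_f A, th_2 B]]lieC c2f.
rewrite oppr0 !addr0 !add0r [[lie th_e A, _]]lieC.
rewrite /th_2 /th_e /th_f.
have bil (C D : sl K N) :
    [lie \sum_(k : 'I_N | (m < k)%N) vsval C k mid *: fbas k,
         \sum_(j : 'I_N | (j < m)%N) vsval D mid j *: ebas j]
    = \sum_(k : 'I_N | (m < k)%N) \sum_(j : 'I_N | (j < m)%N)
        (vsval C k mid * vsval D mid j) *: [lie fbas k, ebas j].
  rewrite lie_suml; apply: eq_bigr => k _; rewrite linear_sum; apply: eq_bigr => j _.
  by rewrite /= lieZl linearZ scalerA.
rewrite !bil -sumrB; apply: eq_bigr => k mk; rewrite -sumrB; apply: eq_bigr => j jm.
rewrite -scalerBl val_lieE (bigD1 mid) //= big1 ?addr0 // => i im.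
have [ij|ij] := leP (deg j) (deg i); first by rewrite (An0 i j) // (Bn0 i j) // !mulr0 subrr.
rewrite (An0 k i) // ?(Bn0 k i) // ?mul0r ?subrr //.
all: by move: ij jm mk im; rewrite -val_eqE /= /bdeg; lia.
Qed.

Lemma theta_elem_e j : (j < m)%N -> theta (E mid j) = ebas j.
Proof.
move=> jm; have mj : mid != j by rewrite eq_sym ltm_mid.
rewrite /theta /th_e (bigD1 j) //= val_elem // mxE !eqxx scale1r big1 => [|i /andP[_ /negPf ij]].
  rewrite addr0 /th_f big1 => [|k mk]; last by rewrite val_elem // mxE (gtm_mid mk) scale0r.
  rewrite /th_2 big1 ?addr0 // => k mk; rewrite big1 // => i _.
  by rewrite val_elem // mxE (gtm_mid mk) scale0r.
by rewrite mxE ij andbF scale0r.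
Qed.

Lemma theta_elem_f k : (m < k)%N -> theta (E k mid) = fbas k.
Proof.
move=> mk; have km : k != mid by rewrite gtm_mid.
rewrite /theta /th_f (bigD1 k) //= val_elem // mxE !eqxx scale1r.
rewrite [X in _ + (_ + X)]big1 => [|i /andP[_ /negPf ij]]; last first.
  by rewrite mxE ij scale0r.
rewrite /th_e big1 => [|j jm]; last by rewrite val_elem // mxE (ltm_mid jm) andbF scale0r.
rewrite /th_2 big1 ?addr0 ?add0r // => i _; rewrite big1 // => j jm.
by rewrite val_elem // mxE (ltm_mid jm) andbF scale0r.
Qed.

Lemma theta_cut A : theta A = theta (sl_cut deg (fun p => p < 0) A).
Proof.
apply/eqP; rewrite -subr_eq0 -linearB /=; apply/eqP.
rewrite /theta /th_e /th_f /th_2 !big1 ?addr0 //.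
- move=> k mk; rewrite big1 // => j jm; rewrite sl_entryD sl_entryN sl_cutE.
  by rewrite !bdegE mk jm (ltnNge k) ltnW //= subrr scale0r.
- move=> k mk; rewrite sl_entryD sl_entryN sl_cutE.
  by rewrite !bdegE mk (ltnNge k) ltnW //= ltnn subrr scale0r.
- move=> j jm; rewrite sl_entryD sl_entryN sl_cutE.
  by rewrite !bdegE jm /= ltnn subrr scale0r.
Qed.

Lemma sl_cut_neg A : sl_cut deg (fun p => p < 0) A \in neg.
Proof. by apply/mem_sl_supp => r c /negPf rc; rewrite sl_cutE rc. Qed.

Lemma e_sub (U : {vspace M}) : (forall j, (j < m)%N -> ebas j \in U) -> (e <= U)%VS.
Proof.
move=> hU; rewrite -(span_basis (vbasisP e)); apply/span_subvP => x xb.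
have jm : (index x (vbasis e) < m)%N.
  by apply: (@leq_trans (size (vbasis e))); rewrite ?index_mem // size_tuple dim_e.
have jN : (index x (vbasis e) < N)%N by rewrite ltnS (leq_trans (ltnW jm)) // leq_addr.
by rewrite -(nth_index 0 xb); exact: (hU (Ordinal jN)).
Qed.

Lemma f_sub (U : {vspace M}) : (forall k, (m < k)%N -> fbas k \in U) -> (f <= U)%VS.
Proof.
move=> hU; rewrite -(span_basis (vbasisP f)); apply/span_subvP => x xb.
have jm : (index x (vbasis f) < n)%N.
  by apply: (@leq_trans (size (vbasis f))); rewrite ?index_mem // size_tuple dim_f.
have jN : (m.+1 + index x (vbasis f) < N)%N by rewrite addSn ltnS ltn_add2l.
have := hU (Ordinal jN); rewrite /fbas /= addnC addnK nth_index //; apply.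
by rewrite addnS ltnS leq_addl.
Qed.

(** The image is a subalgebra, by [theta_lie] after truncation to negative degree, and it contains
    [e] and [f], which generate [M]. *)
Lemma theta_surj u : exists A, theta A = u.
Proof.
pose U := limg (linfun theta).
have UP v : v \in U -> exists A, v = theta A.
  by case/memv_imgP => A _ ->; exists A; rewrite lfunE.
have thU A : theta A \in U by rewrite -[theta A]lfunE memv_img ?memvf.
have Ulie : lie_subalgebra U.
  apply/lie_span_subP => _ _ /UP[A ->] /UP[B ->].
  by rewrite (theta_cut A) (theta_cut B) -theta_lie ?sl_cut_neg.
have eU : (e <= U)%VS by apply: e_sub => j jm; rewrite -theta_elem_e.
have fU : (f <= U)%VS by apply: f_sub => k mk; rewrite -theta_elem_f.
case: fg => hg pos [_ gen].
have gU p : (gM p <= U)%VS.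
  have [p0|/pos ->] := ltP p 0; last exact: sub0v.
  by apply: gen => //; rewrite -gef subv_add eU.
have [s [c [cg ->]]] := gla_span hg u.
have /UP[A ->] : \sum_(p <- s) c p \in U; last by exists A.
by rewrite big_seq; apply: memv_suml => p _; apply: (subvP (gU p)); exact: cg.
Qed.

(** This is where freeness is used. For the functionals dual to [ebas j] and [fbas k], the map to
    [filiform K 2] reads off the entries of [A] at [(mid, j)], [(k, mid)] and, up to sign,
    [(k, j)]. *)
Lemma theta_inj A : A \in neg -> theta A = 0 -> A = 0.
Proof.
move=> /mem_sl_supp An thA.
have key j k : (j < m)%N -> (m < k)%N ->
    [/\ vsval A mid j = 0, vsval A k mid = 0 & vsval A k j = 0].
  move=> jm mk.
  have fe0 : (f :&: e)%VS = 0%VS by rewrite capvC.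
  have je : (j < \dim e)%N by rewrite dim_e.
  have kf : (k - m.+1 < \dim f)%N by rewrite dim_f fbas_ltn.
  have [xi xif xiE] := dual_basis_functional ef0 je.
  have [eta etae etaE] := dual_basis_functional fe0 kf.
  have xie i : (i < m)%N -> xi (ebas i) = (i == j :> nat)%:R by move=> im; rewrite xiE ?dim_e.
  have etaf (i : 'I_N) : (m < i)%N -> eta (fbas i) = (i == k)%:R.
    move=> mi; rewrite etaE ?dim_f ?fbas_ltn //.
    have -> // : (i - m.+1 == k - m.+1)%N = (i == k).
    by apply/eqP/eqP => [h|->//]; apply: val_inj => /=; lia.
  have exa : exists2 a, a \in e & xi a != 0.
    by exists (ebas j); rewrite ?ebas_e // xie // eqxx oner_neq0.
  have exb : exists2 b, b \in f & eta b != 0.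
    by exists (fbas k); rewrite ?fbas_f // etaf // eqxx oner_neq0.
  have [psi [psihom _ psie psif]] := free_quotient_filiform hM xif etae exa exb.
  have pe : psi (th_e A) = vsval A mid j *: fil_a K 2.
    rewrite linear_sum (bigD1 j) //= linearZ /= psie ?ebas_e // xie // eqxx scale1r.
    rewrite big1 ?addr0 // => i /andP[im ij]; rewrite linearZ /= psie ?ebas_e // xie //.
    by rewrite (_ : (i == j :> nat) = false) ?scale0r ?scaler0 //; exact: negPf.
  have pf : psi (th_f A) = vsval A k mid *: fil_v K 2 0.
    rewrite linear_sum (bigD1 k) //= linearZ /= psif ?fbas_f // etaf // eqxx scale1r.
    rewrite big1 ?addr0 // => i /andP[im /negPf ij]; rewrite linearZ /= psif ?fbas_f // etaf //.
    by rewrite ij scale0r scaler0.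
  have pl (i i' : 'I_N) : (m < i)%N -> (i' < m)%N ->
      psi [lie fbas i, ebas i'] = - ((i == k)%:R * (i' == j :> nat)%:R) *: fil_v K 2 1.
    move=> mi im; rewrite psihom psif ?fbas_f // psie ?ebas_e // etaf // xie //.
    by rewrite lieZl linearZ /= lieC fil_lie_av scalerN scalerN scalerA scaleNr.
  have p2 : psi (th_2 A) = - vsval A k j *: fil_v K 2 1.
    rewrite linear_sum (bigD1 k) //= linear_sum (bigD1 j) //= linearZ /= pl // !eqxx mulr1.
    rewrite big1 => [|i /andP[im ij]]; last first.
      rewrite linearZ /= pl // (_ : (i == j :> nat) = false) ?mulr0 ?oppr0 ?scale0r ?scaler0 //.
      exact: negPf.
    rewrite addr0 big1 => [|i /andP[mi /negPf ik]]; last first.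
      rewrite linear_sum big1 // => i' im; rewrite linearZ /= pl // ik mul0r oppr0 scale0r.
      by rewrite scaler0.
    by rewrite addr0 scalerA mulrN1.
  have := congr1 psi thA; rewrite linear0 /theta !linearD /= pe pf p2 => E0.
  have E1 := congr1 fst E0; have E2 := congr1 (fun z : filiform K 2 => z.2 ord0 ord0) E0.
  have E3 := congr1 (fun z : filiform K 2 => z.2 ord0 ord_max) E0.
  move: E1 E2 E3; rewrite /= !mxE /= !scaler0 !addr0 !mulr0 !mulr1 !add0r !addr0.
  by rewrite [_ *: 1]mulr1 => -> -> /eqP; rewrite oppr_eq0 => /eqP ->.
apply: sl_ext => r c; rewrite sl_entry0.
have [rc|/negP rc] := boolP (deg r - deg c < 0); last exact/An/negP.
have j0 : ((ord0 : 'I_N) < m)%N by exact: kind2_m0.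
have k0 : (m < (ord_max : 'I_N))%N by rewrite /= -{1}[m]addn0 ltn_add2l kind2_n0.
move: rc; rewrite !bdegE; case: (ltngtP r m) => rm; case: (ltngtP c m) => cm // _.
- by have [] := key c r cm rm.
- have -> : c = mid by exact: val_inj.
  by have [] := key _ r j0 rm.
- have -> : r = mid by exact: val_inj.
  by have [] := key c _ cm k0.
Qed.

Lemma theta_gr_surj p u : p < 0 -> u \in gM p -> exists2 A, A \in gr p & theta A = u.
Proof.
move=> p0 up; have [A thA] := theta_surj u; case: fg => hg _ _.
exists (sl_cut deg (pred1 p) A); first exact: sl_cut1_gr.
pose s := undup (p :: sl_degs deg).
have sub : {subset sl_degs deg <= s} by move=> q qd; rewrite mem_undup inE qd orbT.
(* These are the homogeneous components of [theta A - u = 0], so each of them vanishes. *)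
pose c q := theta (sl_cut deg (pred1 q) A) - (if q == p then u else 0).
have cg q : c q \in gM q.
  rewrite /c; case: eqP => [->|_]; first by rewrite memvB // theta_gr // sl_cut1_gr.
  by rewrite subr0 theta_gr // sl_cut1_gr.
have ps : p \in s by rewrite mem_undup mem_head.
have c0 : \sum_(q <- s) c q = 0.
  rewrite /c sumrB -linear_sum -(sl_cut_sum A (undup_uniq _) sub) /= thA.
  by rewrite (bigD1_seq p) ?undup_uniq //= eqxx big1 ?addr0 ?subrr // => q /negPf ->.
have := gla_indep hg (undup_uniq _) cg c0 ps; rewrite /c eqxx => /eqP.
by rewrite subr_eq0 => /eqP.
Qed.

End Kind2.

(** * The embedding of [sl_(m+n+1)] into the prolongation and its image *)

Section Embedding.
Variables (K : numFieldType) (M : finLieAlgType K) (gM : int -> {vspace M}) (e f : {vspace M}).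
Variables (m n : nat).
Variables (G : lieAlgType K) (gG : int -> set G) (iota : {linear M -> G}).
Hypothesis hM : free_pseudo_product_fgla gM e f m n 2.
Hypothesis hG : is_prolongation gM gG iota.
Local Notation N := (m + n).+1.
Local Notation deg := (@bdeg m n).
Local Notation gr := (sl_gr K deg).
Local Notation mid := (mid m n).
Local Notation E := (elem_sl K).
Local Notation low := (low K m n).
Local Notation neg := (low 0).
Local Notation th := (@theta K M e f m n).
Implicit Types (A B : sl K N) (r c j i : 'I_N) (p q k : int).

Let fg : is_fgla gM. Proof. by case: hM => [[]]. Qed.
Let gef : (e + f)%VS = gM (-1). Proof. by case: hM => [[_ []]]. Qed.
Let m0 : (0 < m)%N := kind2_m0 hM.
Let n0 : (0 < n)%N := kind2_n0 hM.
Let eg x : x \in e -> x \in gM (-1).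
Proof. by move=> xe; rewrite -gef (subvP (addvSl e f)). Qed.
Let fgg x : x \in f -> x \in gM (-1).
Proof. by move=> xf; rewrite -gef (subvP (addvSr e f)). Qed.

Lemma low_gr p k A : p < k -> A \in gr p -> A \in low k.
Proof.
move=> pk /mem_sl_supp Ap; apply/mem_sl_supp => r c rc; apply: Ap.
by apply: contra rc => /eqP ->.
Qed.

Lemma low_le k k' A : k <= k' -> A \in low k -> A \in low k'.
Proof.
move=> kk /mem_sl_supp Ap; apply/mem_sl_supp => r c rc; apply: Ap.
by apply: contra rc => h; exact: lt_le_trans kk.
Qed.

Lemma low_cut k A : sl_cut deg (fun p => p < k) A \in low k.
Proof. by apply/mem_sl_supp => r c /negPf rc; rewrite sl_cutE rc. Qed.

Lemma low_cut_id k A : A \in low k -> sl_cut deg (fun p => p < k) A = A.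
Proof.
move=> /mem_sl_supp Ap; apply: sl_ext => r c; rewrite sl_cutE.
by case: ifPn => // /Ap ->.
Qed.

Lemma low_gr0 k A : A \in low k -> sl_cut deg (pred1 k) A = 0.
Proof.
move=> /mem_sl_supp Ap; apply: sl_ext => r c; rewrite sl_cutE sl_entry0 /=.
by case: eqP => // rc; apply: Ap; rewrite rc ltxx.
Qed.

Lemma low_split k A : A \in low (k + 1) ->
  A = sl_cut deg (fun p => p < k) A + sl_cut deg (pred1 k) A.
Proof.
move=> /mem_sl_supp Ap; apply: sl_ext => r c; rewrite sl_entryD !sl_cutE /=.
case: ltgtP => rc; rewrite ?add0r ?addr0 //; apply: Ap; lia.
Qed.

Lemma low_lie k A B : A \in low (k + 1) -> B \in neg -> [lie A, B] \in low k.
Proof.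
move=> /mem_sl_supp Ak /mem_sl_supp Bn; apply/mem_sl_supp => r c rc.
rewrite val_lieE big1 // => i _.
have -> : vsval A r i * vsval B i c = 0.
  have [h|/Ak ->] := boolP (deg r - deg i < k + 1); last by rewrite mul0r.
  by rewrite Bn ?mulr0 //; lia.
have -> : vsval B r i * vsval A i c = 0; last by rewrite subr0.
have [h|/Bn ->] := boolP (deg r - deg i < 0); last by rewrite mul0r.
by rewrite Ak ?mulr0 //; lia.
Qed.

Lemma low3 A : A \in low 3.
Proof. by apply/mem_sl_supp => r c; rewrite /bdeg; lia. Qed.

Lemma gr_ge3 p A : 2 < p -> A \in gr p -> A = 0.
Proof.
move=> p2 /mem_sl_supp Ap; apply: sl_ext => r c; rewrite sl_entry0; apply: Ap.
by rewrite /bdeg; lia.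
Qed.

Lemma theta_section : exists tau : {linear M -> sl K N},
  [/\ forall u, tau u \in neg, forall u, th (tau u) = u,
      forall B, B \in neg -> tau (th B) = B &
      forall p u, p < 0 -> u \in gM p -> tau u \in gr p].
Proof.
pose F := linfun th.
pose tau : {linear M -> sl K N} := sl_cut deg (fun p => p < 0) \o (F^-1)%VF.
have taun u : tau u \in neg by exact: low_cut.
have thK u : th (tau u) = u.
  rewrite /tau /= -theta_cut -[LHS](lfunE th) limg_lfunVK //.
  have [A <-] := theta_surj hM u; rewrite -[th A](lfunE th); exact/memv_img/memvf.
have tthK B : B \in neg -> tau (th B) = B.
  move=> Bn; apply/eqP; rewrite -subr_eq0; apply/eqP; apply: (theta_inj hM).
    by rewrite memvB.
  by rewrite linearB /= thK subrr.
exists tau; split=> // p u p0 up.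
have [A Ap <-] := theta_gr_surj hM p0 up.
by rewrite tthK // (low_gr p0 Ap).
Qed.

(** The invariant of the construction by degree: [J] is constrained in degrees below [k], and only
    its brackets with negative elements are controlled. *)
Definition jspec (k : int) (J : {linear sl K N -> G}) : Prop :=
  [/\ forall p A, p < k -> A \in gr p -> gG p (J A),
      forall A B, A \in low k -> B \in neg -> J [lie A, B] = [lie J A, J B] &
      forall B, B \in neg -> J B = iota (th B)].

Lemma jspec0 : jspec 0 (iota \o th).
Proof.
split=> // [p A p0 Ap|A B An Bn] /=; first exact: (gG_iota hG fg (theta_gr hM Ap)).
by rewrite (theta_lie hM) // (pro_hom hG).
Qed.

(** For [A] of degree [k], the map [u |-> J [A, tau u]] is a derivation of degree [k] from [M] to
    [G]; fullness represents it by an element [X A], the new value at [A]. Here [tau] inverts [th]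
    on the negative part. *)
Lemma jspec_step k J : 0 <= k -> jspec k J -> exists J', jspec (k + 1) J'.
Proof.
move=> k0 [Jg Jl Jn]; have [tau [taun thK tthK taug]] := theta_section.
pose C A := sl_cut deg (pred1 k) A.
have ex A : exists X, gG k X /\ forall u, [lie X, iota u] = J [lie C A, tau u].
  pose D : {linear M -> G} := J \o lie (C A) \o tau.
  have Ck : C A \in low (k + 1) by apply: (@low_gr k); [lia|exact: sl_cut1_gr].
  have [p u up|u v|X Xk XD] := @pro_full _ _ _ _ _ _ hG k D k0.
  - have [p0|p0] := ltP p 0; last first.
      case: fg => _ pos _; move: up; rewrite pos // memv0 => /eqP ->.
      by rewrite linear0; exact: (gG0 hG).
    apply: Jg; first by lia.
    by rewrite addrC; apply: sl_gr_lie; [exact: sl_cut1_gr|exact: taug].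
  - have tauL : tau [lie u, v] = [lie tau u, tau v].
      by rewrite -{1}(thK u) -{1}(thK v) -(theta_lie hM) // tthK // (low_lie (k := 0)) //
        (low_le (k := 0)).
    rewrite /D /= tauL lie_leibniz linearD /= Jl ?(low_lie Ck) //.
    rewrite (Jn (tau v)) // thK; congr (_ + _).
    by rewrite [[lie tau u, _]]lieC linearN /= (Jl [lie C A, tau v]) ?(low_lie Ck) // (Jn (tau u)) // thK -lieC.
  by exists X; split=> // u; rewrite -XD.
have [X XP] := choice ex.
have Xk A : gG k (X A) by case: (XP A).
have XE A u : [lie X A, iota u] = J [lie C A, tau u] by case: (XP A).
(* The choice of [X A] carries no linearity; it comes from uniqueness, by transitivity. *)
have Xlin : linear X.
  move=> a A B; apply/eqP; rewrite -subr_eq0; apply/eqP.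
  apply: (gG_eq0 hG fg k0); first by apply: (gGB hG) => //; exact: (gG_linear hG).
  move=> u _; rewrite lieBl lieDl lieZl !XE /C linearP /= lieDl lieZl linearP /=.
  by rewrite subrr.
have X0 A : A \in low k -> X A = 0.
  move=> Ak; apply: (gG_eq0 hG fg k0 (Xk A)) => u _.
  by rewrite XE /C low_gr0 // lie0l linear0.
pose XL : {linear sl K N -> G} := HB.pack X (GRing.isLinear.Build _ _ _ _ X Xlin).
pose J0 A := J (sl_cut deg (fun p => p < k) A) + XL A.
have J0lin : linear J0.
  by move=> a A B; rewrite /J0 !linearP /= scalerDr addrACA.
pose J' : {linear sl K N -> G} := HB.pack J0 (GRing.isLinear.Build _ _ _ _ J0 J0lin).
have J'low A : A \in low k -> J' A = J A.
  by move=> Ak; rewrite /= /J0 /= X0 // addr0 low_cut_id.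
have neglow B : B \in neg -> B \in low k by exact: low_le.
exists J'; split.
- move=> p A pk Ap; have [pk'|pk'] := ltP p k.
    by rewrite J'low ?(low_gr pk') //; exact: Jg.
  have E1 : p = k by lia.
  move: Ap; rewrite E1 => Ap /=; rewrite /J0 (sl_cut0 Ap) /= ?ltxx //.
  by rewrite linear0 add0r.
- move=> A B Ak Bn; rewrite J'low ?(low_lie Ak) // (J'low B) ?neglow //.
  rewrite {1}(low_split Ak) lieDl linearD /= Jl ?low_cut // /J0 lieDl; congr (_ + _).
  by rewrite (Jn B) // XE tthK.
- by move=> B Bn; rewrite J'low ?neglow // Jn.
Qed.

(** The degrees of [sl_(m+n+1)] do not exceed 2, so the three steps in degrees 0, 1 and 2 reach
    everything. *)
Lemma embedding_exists : exists J, jspec 3 J.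
Proof.
have [J1 h1] := jspec_step (lexx 0) jspec0.
have [|J2 h2] := jspec_step _ h1; first by [].
have [|J3 h3] := jspec_step _ h2; first by [].
have jspecE k k' : k = k' -> jspec k J3 -> jspec k' J3 by move->.
by exists J3; apply: jspecE h3.
Qed.

Variable J : {linear sl K N -> G}.
Hypothesis hJ : jspec 3 J.

Let Jneg B : B \in neg -> J B = iota (th B). Proof. by case: hJ => _ _; exact. Qed.

Let Jl A B : B \in neg -> J [lie A, B] = [lie J A, J B].
Proof. by case: hJ => _ h _ Bn; rewrite h // low3. Qed.

Lemma J_gr p A : A \in gr p -> gG p (J A).
Proof.
move=> Ap; have [p3|p3] := ltP p 3; first by case: hJ => h _ _; exact: h.
by rewrite (gr_ge3 _ Ap) ?linear0; [exact: (gG0 hG)|lia].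
Qed.

Lemma neg_gr p A : p < 0 -> A \in gr p -> A \in neg.
Proof. exact: low_gr. Qed.

(** If both degrees are nonnegative, the difference of the two sides is tested against degree -1.
    The Leibniz rule turns this into the same identity with total degree one less, and transitivity
    concludes. *)
Lemma J_lie_gr (s : nat) p q A B : A \in gr p -> B \in gr q -> p + q < s%:Z ->
  J [lie A, B] = [lie J A, J B].
Proof.
elim: s p q A B => [|s IH] p q A B Ap Bq pqs;
  (have [q0|q0] := ltP q 0; first exact/Jl/(neg_gr q0));
  (have [p0|p0] := ltP p 0; first by rewrite lieC linearN /= Jl ?(neg_gr p0 Ap) // -lieC);
  first by lia.
have pq0 : 0 <= p + q by rewrite addr_ge0.
apply/eqP; rewrite -subr_eq0; apply/eqP; apply: (gG_eq0 hG fg pq0).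
  apply: (gGB hG); first exact: (J_gr (sl_gr_lie Ap Bq)).
  exact: (gG_lie hG (J_gr Ap) (J_gr Bq)).
move=> u u1; have N1 : -1 < 0 :> int by [].
have [C Cp <-] := theta_gr_surj hM N1 u1.
have Cn := neg_gr N1 Cp.
rewrite -Jneg // lieBl -(Jl _ Cn) (lie_leibnizl A B C) linearD /= (lie_leibnizl (J A)) -(Jl A Cn) -(Jl B Cn).
rewrite (IH _ _ _ _ (sl_gr_lie Ap Cp) Bq) ?(IH _ _ _ _ Ap (sl_gr_lie Bq Cp)) ?subrr //; lia.
Qed.

Lemma J_lie : lie_hom J.
Proof.
move=> A B.
have sd (x : sl K N) : x = \sum_(p <- sl_degs deg) sl_cut deg (pred1 p) x.
  by apply: sl_cut_sum; rewrite ?undup_uniq.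
rewrite (sd A) lie_suml !linear_sum /= lie_suml; apply: eq_bigr => p _.
rewrite (sd B) !linear_sum /=; apply: eq_bigr => q _.
apply: (@J_lie_gr `|p + q|.+1 p q); rewrite ?sl_cut1_gr //; lia.
Qed.

Lemma elem_neg r c : (c < r)%N -> (c <= m)%N -> (m <= r)%N -> E r c \in neg.
Proof.
move=> cr cm mr; have rc : r != c by apply/eqP => rc; rewrite rc ltnn in cr.
by apply: low_gr (sl_gr_elem K deg rc); rewrite /bdeg; lia.
Qed.

Lemma J_elem_e j : (j < m)%N -> J (E mid j) = iota (ebas e j).
Proof. by move=> jm; rewrite Jneg ?theta_elem_e // elem_neg // ltnW. Qed.

Lemma J_elem_f i : (m < i)%N -> J (E i mid) = iota (fbas f m i).
Proof. by move=> mi; rewrite Jneg ?theta_elem_f // elem_neg // ltnW. Qed.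

Lemma J_inj : injective J.
Proof.
have [U UP] := vspace_ker J.
have idU : lie_ideal U.
  by apply/lie_span_subP => x y _ /UP y0; apply/UP; rewrite J_lie y0 linear0.
have N2 : (1 < N)%N by rewrite ltnS addn_gt0 m0.
have [U0|Uf] := (sl_lie_simple K N2).2 U idU.
  move=> A B AB; apply/eqP; rewrite -subr_eq0 -memv0 -U0; apply/UP.
  by rewrite linearB /= AB subrr.
have j0 : ((ord0 : 'I_N) < m)%N by [].
have := memvf (E mid ord0); rewrite -Uf => /UP; rewrite J_elem_e // => E0.
have mj : mid != ord0 by rewrite eq_sym ltm_mid.
have En : E mid ord0 \in neg by rewrite elem_neg // ltnW.
have := elem_neq0 K mj; rewrite (theta_inj hM En) ?eqxx // theta_elem_e //.
by apply: (pro_inj hG); rewrite E0 linear0.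
Qed.

Lemma killed_on_bases X k : 0 <= k -> gG k X ->
  (forall j, (j < m)%N -> [lie X, iota (ebas e j)] = 0) ->
  (forall i, (m < i)%N -> [lie X, iota (fbas f m i)] = 0) -> X = 0.
Proof.
move=> k0 Xk Xe Xf; apply: (gG_eq0 hG fg k0 Xk) => u; rewrite -gef.
have [U UP] := vspace_ker (lie X \o iota).
suff /subvP sU : (e + f <= U)%VS by move=> /sU/UP.
rewrite subv_add; apply/andP; split.
  by apply: (e_sub hM) => j jm; apply/UP; exact: Xe.
by apply: (f_sub hM) => i mi; apply/UP; exact: Xf.
Qed.

Local Notation pp := (pp_prolongation gG iota e f).

(** A matrix of degree 0 is block diagonal, so the negative part of [[A, E mid j]] still lies in row
    [mid]. *)
Lemma J_preserves_e A : A \in gr 0 -> preserves iota (J A) e.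
Proof.
move=> A0; have [tau [taun thK tthK taug]] := theta_section.
pose D : {linear M -> M} := th \o lie A \o tau.
have DE u : u \in gM (-1) -> [lie J A, iota u] = iota (D u).
  move=> u1; rewrite -{1}(thK u) -Jneg // -J_lie Jneg //.
  by apply: (@neg_gr (0 + -1)); rewrite ?add0r // -[-1]add0r sl_gr_lie // taug.
have [U UP] : exists U : {vspace M}, forall u, u \in U <-> D u \in e.
  apply: vspace_of_pred => [|a x y xe ye]; first by rewrite linear0 mem0v.
  by rewrite linearP memvD // memvZ.
suff /subvP eU : (e <= U)%VS by move=> u ue; exists (D u); [exact/UP/eU|exact/DE/eg].
apply: (e_sub hM) => j jm; apply/UP.
have mj : mid != j by rewrite eq_sym ltm_mid.
rewrite /D /= -(theta_elem_e e f jm) tthK; last by rewrite elem_neg // ltnW.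
rewrite /theta /th_f big1 => [|k mk]; last first.
  rewrite val_lie_elem // (gtm_mid mk) mul0r subr0.
  have /mem_sl_supp -> := A0; rewrite ?mul0r ?scale0r //.
  by rewrite /bdeg /=; lia.
rewrite addr0 /th_2 big1 ?addr0 ?(th_e_e hM) // => k mk; rewrite big1 // => i im.
rewrite val_lie_elem // (gtm_mid mk) mul0r subr0.
have /mem_sl_supp -> := A0; rewrite ?mul0r ?scale0r //.
by rewrite /bdeg /=; lia.
Qed.

Lemma J_preserves_f A : A \in gr 0 -> preserves iota (J A) f.
Proof.
move=> A0; have [tau [taun thK tthK taug]] := theta_section.
pose D : {linear M -> M} := th \o lie A \o tau.
have DE u : u \in gM (-1) -> [lie J A, iota u] = iota (D u).
  move=> u1; rewrite -{1}(thK u) -Jneg // -J_lie Jneg //.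
  by apply: (@neg_gr (0 + -1)); rewrite ?add0r // -[-1]add0r sl_gr_lie // taug.
have [U UP] : exists U : {vspace M}, forall u, u \in U <-> D u \in f.
  apply: vspace_of_pred => [|a x y xe ye]; first by rewrite linear0 mem0v.
  by rewrite linearP memvD // memvZ.
suff /subvP fU : (f <= U)%VS by move=> u uf; exists (D u); [exact/UP/fU|exact/DE/fgg].
apply: (f_sub hM) => i mi; apply/UP.
have im : i != mid by rewrite gtm_mid.
rewrite /D /= -(theta_elem_f e f mi) tthK; last by rewrite elem_neg // ltnW.
rewrite /theta /th_e big1 => [|j jm]; last first.
  rewrite val_lie_elem // (ltm_mid jm) mulr0 sub0r.
  have /mem_sl_supp -> := A0; rewrite ?mulr0 ?oppr0 ?scale0r //.
  by rewrite /bdeg /=; lia.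
rewrite add0r /th_2 big1 ?addr0 ?(th_f_f hM) // => k mk; rewrite big1 // => j jm.
rewrite val_lie_elem // (ltm_mid jm) mulr0 sub0r.
have /mem_sl_supp -> := A0; rewrite ?mulr0 ?oppr0 ?scale0r //.
by rewrite /bdeg /=; lia.
Qed.

Lemma J_pp (s : nat) k A : k < s%:Z -> A \in gr k -> pp k (J A).
Proof.
elim: s k A => [|s IH] k A ks Ak.
  by apply: pp_pro_neg; [lia|exact: J_gr].
case: (ltgtP k 0) => [k0|k0|k0].
- by apply: pp_pro_neg; [|exact: J_gr].
- apply: pp_pro_pos => // [|q Y q0 Yq]; first exact: J_gr.
  have [u uq ->] := gG_negE hG q0 Yq; have [B Bq <-] := theta_gr_surj hM q0 uq.
  rewrite -Jneg ?(neg_gr q0 Bq) // -J_lie; apply: IH; first by lia.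
  exact: sl_gr_lie.
- move: Ak; rewrite k0 => A0; apply: pp_pro_zero; first exact: J_gr.
    exact: J_preserves_e.
  exact: J_preserves_f.
Qed.

(** The zeros in column [mid] are what the hypothesis [P_mid] of [derivation_inner] asks for in
    degree 0. *)
Lemma e_lift v : v \in e -> exists P, [/\ P \in gr (-1), J P = iota v &
  forall i, (m < i)%N -> vsval P i mid = 0].
Proof.
have [U UP] : exists U : {vspace M}, forall v, v \in U <-> exists P,
    [/\ P \in gr (-1), J P = iota v & forall i, (m < i)%N -> vsval P i mid = 0].
  apply: vspace_of_pred.
    by exists 0; rewrite mem0v !linear0; split=> // i _; rewrite mxE.
  move=> a x y [P [P1 Px Pi]] [Q [Q1 Qx Qi]]; exists (a *: P + Q).
  rewrite memvD ?memvZ // (linearP J) (linearP iota) Px Qx; split=> // i mi.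
  by rewrite sl_entryD sl_entryZ Pi // Qi // mulr0 addr0.
move=> ve; apply/UP; suff /subvP : (e <= U)%VS by apply.
apply: (e_sub hM) => j jm; apply/UP; exists (E mid j).
have mj : mid != j by rewrite eq_sym ltm_mid.
rewrite J_elem_e //; split=> // [|i mi].
  have -> : -1 = deg mid - deg j by rewrite /bdeg /=; lia.
  exact: sl_gr_elem.
by rewrite val_elem // mxE (gtm_mid mi).
Qed.

Lemma f_lift v : v \in f -> exists Q, [/\ Q \in gr (-1), J Q = iota v &
  forall i, (i < m)%N -> vsval Q mid i = 0].
Proof.
have [U UP] : exists U : {vspace M}, forall v, v \in U <-> exists Q,
    [/\ Q \in gr (-1), J Q = iota v & forall i, (i < m)%N -> vsval Q mid i = 0].
  apply: vspace_of_pred.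
    by exists 0; rewrite mem0v !linear0; split=> // i _; rewrite mxE.
  move=> a x y [P [P1 Px Pi]] [Q [Q1 Qx Qi]]; exists (a *: P + Q).
  rewrite memvD ?memvZ // (linearP J) (linearP iota) Px Qx; split=> // i mi.
  by rewrite sl_entryD sl_entryZ Pi // Qi // mulr0 addr0.
move=> vf; apply/UP; suff /subvP : (f <= U)%VS by apply.
apply: (f_sub hM) => k mk; apply/UP; exists (E k mid).
have km : k != mid by rewrite gtm_mid.
rewrite J_elem_f //; split=> // [|i im].
  have -> : -1 = deg k - deg mid by rewrite /bdeg /=; lia.
  exact: sl_gr_elem.
by rewrite val_elem // mxE (ltm_mid im) andbF.
Qed.

(** By induction on the degree, the brackets of [X] with the bases of [e] and [f] are images under
    [J]. Injectivity of [J] carries the derivation identities back to [sl], where [derivation_inner]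
    produces [Z]; then [J Z - X] kills [e] and [f]. *)
Lemma pp_J (s : nat) k X : k < s%:Z -> pp k X -> exists2 A, A \in gr k & J A = X.
Proof.
elim: s k X => [|s IH] k X ks Xk; (have [k0|k0] := ltP k 0; first by
  have [u uk ->] := gG_negE hG k0 (pp_gG Xk);
  have [A Ak <-] := theta_gr_surj hM k0 uk; exists A; rewrite // Jneg // (neg_gr k0 Ak));
  first by lia.
have N1 : -1 < 0 :> int by [].
(* For [k > 0] the lift comes from the induction hypothesis and the zeros in column [mid] from its
   degree. For [k = 0] both come from [e_lift], because [X] preserves [e]. *)
have exP j : exists P, (j < m)%N -> [/\ P \in gr (k - 1), J P = [lie X, iota (ebas e j)] &
    forall i, (m < i)%N -> vsval P i mid = 0].
  have [jm|] := boolP (j < m)%N; last by exists 0.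
  have ej := ebas_e hM jm.
  case: (ltgtP k 0) k0 => // [k0|k0] _.
    have [|P Pk JP] := IH (k - 1) _ _ (pp_lie Xk k0 N1 (gG_iota hG fg (eg ej))); first by lia.
    exists P => _; split=> // i mi; move/mem_sl_supp: Pk => ->//.
    by rewrite /bdeg /=; lia.
  move: Xk; rewrite k0 sub0r => /pp_preserves[/(_ _ ej)[v ve ->] _].
  by have [P [P1 PJ Pi]] := e_lift ve; exists P.
have exQ i : exists Q, (m < i)%N -> [/\ Q \in gr (k - 1), J Q = [lie X, iota (fbas f m i)] &
    forall j, (j < m)%N -> vsval Q mid j = 0].
  have [mi|] := boolP (m < i)%N; last by exists 0.
  have fi := fbas_f hM mi.
  case: (ltgtP k 0) k0 => // [k0|k0] _.
    have [|P Pk JP] := IH (k - 1) _ _ (pp_lie Xk k0 N1 (gG_iota hG fg (fgg fi))); first by lia.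
    exists P => _; split=> // j jm; move/mem_sl_supp: Pk => ->//.
    by rewrite /bdeg /=; lia.
  move: Xk; rewrite k0 sub0r => /pp_preserves[_ /(_ _ fi)[v vf ->]].
  by have [P [P1 PJ Pi]] := f_lift vf; exists P.
have [P PP] := choice exP; have [Q QQ] := choice exQ.
have JE i j : (j < m)%N -> (m < i)%N -> J (E i j) = [lie J (E i mid), J (E mid j)].
  move=> jm mi; rewrite -J_lie lie_elem //; first by rewrite gtm_mid.
    by rewrite eq_sym ltm_mid.
  by rewrite eq_sym ltm_gtm.
(* Kind two enters here: degree -2 is central in [M]. Applying [X] to this vanishing bracket gives
   [derE] and [derF]. *)
have central i j u : (j < m)%N -> (m < i)%N -> u \in gM (-1) ->
    [lie [lie J (E i mid), J (E mid j)], iota u] = 0.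
  move=> jm mi u1; rewrite J_elem_e // J_elem_f // -!(pro_hom hG).
  have u2 : exists2 p : int, p < 0 & u \in gM p by exists (-1).
  rewrite (gM_m2_central hM _ u2) ?linear0 //.
  exact: (gM_lie fg (fgg (fbas_f hM mi)) (eg (ebas_e hM jm))).
have der i j u T : (j < m)%N -> (m < i)%N -> u \in gM (-1) -> J T = [lie X, iota u] ->
    [lie [lie J (Q i), J (E mid j)] + [lie J (E i mid), J (P j)], iota u] + [lie J (E i j), J T] = 0.
  move=> jm mi u1 JT; have [_ -> _] := PP j jm; have [_ -> _] := QQ i mi.
  rewrite JT (JE i j) // -(J_elem_e jm) -(J_elem_f mi) -lie_leibniz -lie_leibniz.
  by rewrite central // linear0.
have [||||||Z Zk [ZP ZQ]] := @derivation_inner K m n P Q k m0 n0 k0.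
- by move=> j jm; have [] := PP j jm.
- by move=> i mi; have [] := QQ i mi.
- by move=> j i jm mi; have [_ _] := PP j jm; apply.
- by move=> j i jm mi; have [_ _] := QQ i mi; apply.
- move=> j j' i jm jm' mi; apply: J_inj; rewrite linear0 linearD /= !J_lie linearD /= !J_lie.
  rewrite (J_elem_e jm'); apply: der => //; first exact: (eg (ebas_e hM jm')).
  by have [] := PP j' jm'.
- move=> j i i' jm mi mi'; apply: J_inj; rewrite linear0 linearD /= !J_lie linearD /= !J_lie.
  rewrite (J_elem_f mi'); apply: der => //; first exact: (fgg (fbas_f hM mi')).
  by have [] := QQ i' mi'.
exists Z => //; apply/eqP; rewrite -subr_eq0; apply/eqP.
apply: (killed_on_bases k0); first by apply: (gGB hG); [exact: J_gr|exact: pp_gG Xk].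
  move=> j jm; rewrite lieBl -{1}J_elem_e // -J_lie ZP //.
  by have [_ -> _] := PP j jm; rewrite subrr.
move=> i mi; rewrite lieBl -{1}J_elem_f // -J_lie ZQ //.
by have [_ -> _] := QQ i mi; rewrite subrr.
Qed.

End Embedding.

Theorem theorem2 (R : realType)
    (M : finLieAlgType R[i]) (gM : int -> {vspace M}) (e f : {vspace M})
    (m n mu : nat) (hM : free_pseudo_product_fgla gM e f m n mu)
    (G : lieAlgType R[i]) (gG : int -> set G) (iota : {linear M -> G})
    (hG : is_prolongation gM gG iota)
    (h1 : exists2 X, pp_prolongation gG iota e f 1 X & X <> 0) :
  exists (L : finLieAlgType R[i]) (gL : int -> {vspace L}) (j : {linear L -> G}),
    [/\ injective j, lie_hom j,
        forall p, j @` vgrading gL p = pp_prolongation gG iota e f p &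
        simple_gla_of_type gL (cartan_matrix_A (m + n)) (roots_m_m1 m n)].
Proof.
have [mu3|mu2] := ltnP 2 mu.
  by case: h1 => X X1 []; exact: (kind_ge3_pp1 hG hM mu3).
have mu_2 : mu = 2.
  by case: (hM) => [_ [mu2' _] _ _]; apply/eqP; rewrite eqn_leq mu2.
rewrite {mu}mu_2 in hM mu2 *.
have [J hJ] := embedding_exists hM hG.
exists (sl R[i] (m + n).+1), (sl_gr R[i] (@bdeg m n)), J; split.
- exact: (J_inj hM hG hJ).
- exact: (J_lie hM hG hJ).
- move=> p; apply/seteqP; split=> [_ [A /= Ap <-]|X Xp].
    by apply: (J_pp hM hG hJ (s := `|p|.+1)) => //; lia.
  have [|A Ap <-] := pp_J hM hG hJ (s := `|p|.+1) _ Xp; first by lia.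
  by exists A.
- exact: sl_simple_gla (kind2_m0 hM) (kind2_n0 hM).
Qed.
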